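(* Let $(K,\nu)$ be a valued field and $\omega$ a valuation transcendental extension of $\nu$ to $K(x)$. Take a minimal field of definition $K(a)$ for $\omega$. Assume that $a$ is purely inseparable over $K$. Then $IC(K(x)|K,\omega)=K^h$.
   Context: Values are written additively, $\nu 0=\infty$; for a valued field $(L,\nu)$, $\nu L$ and $L\nu$ denote the value group and residue field. $\overline{K}$ is a fixed algebraic closure of $K$. An extension $\omega$ of $\nu$ to the rational function field $K(x)$ is value transcendental if $\dim_{\mathbb{Q}}\big((\omega K(x)/\nu K)\otimes_{\mathbb{Z}}\mathbb{Q}\big)=1$, residue transcendental if $\mathrm{trdeg}[K(x)\omega:K\nu]=1$, and valuation transcendental if it is one of these. Given an extension $\overline{\omega}$ of $\omega$ to $\overline{K}(x)$, let $\overline{\nu}=\overline{\omega}|_{\overline{K}}$. For $a\in\overline{K}$ and $\gamma$ in an ordered abelian group containing $\overline{\nu}\,\overline{K}$, $\overline{\nu}_{a,\gamma}$ is the valuation on $\overline{K}(x)$ determined by $\overline{\nu}_{a,\gamma}\big(\sum_i c_i(x-a)^i\big)=\min_i\{\overline{\nu}c_i+i\gamma\}$ ($c_i\in\overline{K}$). A pair $(a,\gamma)$ with $a\in\overline{K}$, $\gamma\in\overline{\omega}\,\overline{K}(x)$ is a pair of definition for $\omega$ (with respect to $\overline{\omega}$) if $\overline{\omega}=\overline{\nu}_{a,\gamma}$; it is a minimal pair of definition if moreover for every $b\in\overline{K}$, $\overline{\nu}(a-b)\geq\gamma$ implies $[K(a):K]\leq[K(b):K]$. A minimal field of definition for $\omega$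 is a field $K(a)$ where $(a,\gamma)$ is a minimal pair of definition for $\omega$. Standing convention: given a minimal field of definition $K(a)$, one fixes an extension $\overline{\omega}$ of $\omega$ to $\overline{K}(x)$ which has $(a,\gamma)$ as a minimal pair of definition for some $\gamma\in\overline{\omega}\,\overline{K}(x)$, and an extension of $\overline{\omega}$ to an algebraic closure $\overline{K(x)}$ of $\overline{K}(x)$. $K^h$ is the henselization of $K$ inside $\overline{K}$ with respect to $\overline{\nu}$; $K(x)^h$ is the henselization of $(K(x),\omega)$ inside $\overline{K(x)}$ with respect to the fixed extension; and $IC(K(x)|K,\omega):=\overline{K}\cap K(x)^h$. *)

(* Defs.v *)
From HB Require Import structures.
From mathcomp Require Import all_boot all_order all_algebra fraction generic_quotient.
From mathcomp Require Import boolp classical_sets.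

Set Implicit Arguments.
Unset Strict Implicit.
Unset Printing Implicit Defensive.

Import Order.TTheory GRing.Theory.

Local Open Scope classical_set_scope.
Local Open Scope ring_scope.

Record orderedAbType := OrderedAb {
  oag_sort :> Num.POrderedZmodule.type;
  oag_total : total (<=%R : rel oag_sort);
  oag_leD2l : forall z x y : oag_sort, x <= y -> z + x <= z + y
}.

(* [option G] is the set of values: G together with oo, encoded as [None]. *)
Section Values.
Variable G : orderedAbType.
Implicit Types x y : option G.

Definition val_add x y : option G :=
  if x is Some g then if y is Some h then Some (g + h) else None else None.

Definition val_le x y : bool :=
  if y is Some h then if x is Some g then g <= h else false else true.

Definition val_min x y : option G := if val_le x y then x else y.

End Values.

Record valuation (L : fieldType) (G : orderedAbType) := Valuation {
  valuation_fun :> L -> option G;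
  valuation_eq_oo : forall z, valuation_fun z = None <-> z = 0;
  valuationM : forall y z,
    valuation_fun (y * z) = val_add (valuation_fun y) (valuation_fun z);
  valuationD : forall y z,
    val_le (val_min (valuation_fun y) (valuation_fun z)) (valuation_fun (y + z))
}.

Definition value_group (L : fieldType) (G : orderedAbType)
  (v : valuation L G) : set G := [set g | exists z, v z = Some g].

Section Restriction.
Variables (K L : fieldType) (G : orderedAbType).
Variables (f : {rmorphism K -> L}) (w : valuation L G).

Fact val_restr_eq_oo z : w (f z) = None <-> z = 0.
Proof.
rewrite valuation_eq_oo; split=> [/eqP|->]; last by rewrite rmorph0.
by rewrite fmorph_eq0 => /eqP.
Qed.

Fact val_restrM y z : w (f (y * z)) = val_add (w (f y)) (w (f z)).
Proof. by rewrite rmorphM valuationM. Qed.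

Fact val_restrD y z : val_le (val_min (w (f y)) (w (f z))) (w (f (y + z))).
Proof. by rewrite rmorphD valuationD. Qed.

Definition val_restr : valuation K G :=
  @Valuation K G (fun z => w (f z)) val_restr_eq_oo val_restrM val_restrD.

Definition val_extends (v : valuation K G) : Prop := forall z, w (f z) = v z.

End Restriction.

(* The field K(x). *)
Notation ratfun K := {fraction {poly K}}.

Definition ratC (K : fieldType) : {rmorphism K -> ratfun K} :=
  (@FracField.tofrac {poly K} \o polyC)%FUN.

(* The inclusion of K(x) in L(x) induced by f : K -> L. *)
Section RationalFunctions.
Variables (K L : fieldType) (f : {rmorphism K -> L}).
Local Notation "p %:F" := (@FracField.tofrac _ p).

Definition ratfun_map (r : ratfun K) : ratfun L :=
  (map_poly f (frac (repr r)).1)%:F / (map_poly f (frac (repr r)).2)%:F.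

Fact ratfun_reprE (r : ratfun K) : r * (frac (repr r)).2%:F = (frac (repr r)).1%:F.
Proof.
rewrite -{1}[r]reprK; set q := repr r.
rewrite /FracField.tofrac; unlock; rewrite -[LHS]FracField.pi_mul.
rewrite /FracField.mulf; apply/eqmodP.
rewrite /= FracField.equivfE !numden_Ratio ?mulf_neq0 ?oner_neq0 //.
  by rewrite !mulr1 mulrC.
all: exact: denom_ratioP.
Qed.

Fact ratfun_map_eq (r : ratfun K) n d : d != 0 -> r * d%:F = n%:F ->
  ratfun_map r = (map_poly f n)%:F / (map_poly f d)%:F.
Proof.
move=> d0 rdn; have q0 : (frac (repr r)).2 != 0 by apply: denom_ratioP.
have Eq : (frac (repr r)).1 * d = n * (frac (repr r)).2.
  by apply/eqP; rewrite -tofrac_eq !tofracM -rdn -ratfun_reprE mulrAC.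
apply/eqP; rewrite eqr_div ?tofrac_eq0 ?map_poly_eq0 //.
by rewrite -!tofracM tofrac_eq -!rmorphM Eq.
Qed.

Fact ratfun_map_tofrac p : ratfun_map p%:F = (map_poly f p)%:F.
Proof.
by rewrite (@ratfun_map_eq _ p 1) ?oner_neq0 ?tofrac1 ?mulr1 ?rmorph1 ?invr1 ?mulr1.
Qed.

Fact ratfun_map_is_zmod_morphism : zmod_morphism ratfun_map.
Proof.
move=> r s; have rE := ratfun_reprE r; have sE := ratfun_reprE s.
have r0 : (frac (repr r)).2 != 0 by apply: denom_ratioP.
have s0 : (frac (repr s)).2 != 0 by apply: denom_ratioP.
rewrite (ratfun_map_eq r0 rE) (ratfun_map_eq s0 sE).
move: (frac (repr r)).1 (frac (repr r)).2 rE r0 => n d rE d0.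
move: (frac (repr s)).1 (frac (repr s)).2 sE s0 => m e sE e0.
rewrite (@ratfun_map_eq _ (n * e - m * d) (d * e)) ?mulf_neq0 //; last first.
  by rewrite tofracB !tofracM mulrBl -rE -sE !mulrA [s * _ * _]mulrAC.
rewrite -[in RHS]mulNr addf_div ?tofrac_eq0 ?map_poly_eq0 //.
by rewrite mulNr -!tofracM -tofracB -!rmorphM -rmorphB.
Qed.

Fact ratfun_map_is_monoid_morphism : monoid_morphism ratfun_map.
Proof.
split=> [|r s]; first by rewrite -tofrac1 ratfun_map_tofrac rmorph1.
have rE := ratfun_reprE r; have sE := ratfun_reprE s.
have r0 : (frac (repr r)).2 != 0 by apply: denom_ratioP.
have s0 : (frac (repr s)).2 != 0 by apply: denom_ratioP.
rewrite (ratfun_map_eq r0 rE) (ratfun_map_eq s0 sE).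
move: (frac (repr r)).1 (frac (repr r)).2 rE r0 => n d rE d0.
move: (frac (repr s)).1 (frac (repr s)).2 sE s0 => m e sE e0.
rewrite (@ratfun_map_eq _ (n * m) (d * e)) ?mulf_neq0 //; last first.
  by rewrite !tofracM -rE -sE mulrACA.
by rewrite mulf_div -!tofracM -!rmorphM.
Qed.

HB.instance Definition _ :=
  GRing.isZmodMorphism.Build (ratfun K) (ratfun L) ratfun_map
    ratfun_map_is_zmod_morphism.
HB.instance Definition _ :=
  GRing.isMonoidMorphism.Build (ratfun K) (ratfun L) ratfun_map
    ratfun_map_is_monoid_morphism.

End RationalFunctions.

Section FieldExtension.
Variables (K L : fieldType) (f : {rmorphism K -> L}).

(* A [divringClosed] predicate on a field is a subfield, so this is K(S). *)
Definition adjoin (S : set L) : set L :=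
  [set z | forall F : divringClosed L,
     (forall c, f c \in F) -> (forall s, S s -> s \in F) -> z \in F].

Definition algebraic_over (F : set L) (z : L) : Prop :=
  exists p : {poly L}, [/\ p != 0, forall i, F p`_i & root p z].

(* [F : K] = n, i.e. the K-vector space F has a basis (e_i)_(i < n). *)
Definition has_degree (F : set L) (n : nat) : Prop :=
  exists e : 'I_n -> L,
    (forall c : 'rV[K]_n, \sum_i f (c 0 i) * e i = 0 -> c = 0) /\
    F = [set z | exists c : 'rV[K]_n, z = \sum_i f (c 0 i) * e i].

(* {t} is a transcendence basis of L | K for some t. *)
Definition trdeg_eq1 : Prop :=
  exists t : L, ~ algebraicOver f t /\
    forall z, algebraic_over (adjoin [set t]) z.

(* z^q lies in K for some power q of the characteristic exponent of K; in
   characteristic 0, [[pchar K].-nat q] means q = 1. *)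
Definition purely_inseparable_elt (z : L) : Prop :=
  exists2 q, [pchar K].-nat q & exists c, z ^+ q = f c.

End FieldExtension.

Section Transcendence.
Variables (K L : fieldType) (G : orderedAbType) (f : {rmorphism K -> L}).
Variables (v : valuation K G) (w : valuation L G).

(* phi : A -> V induces an isomorphism from (A / B) tensor rat to V: every
   additive map from A to a rat-vector space that vanishes on B factors
   uniquely through phi. Only the restrictions of phi and psi to A matter. *)
Definition is_quotient_tensor_rat (A B : set G) (V : lmodType rat)
  (phi : G -> V) : Prop :=
  let additive_mod (W : lmodType rat) (psi : G -> W) :=
    (forall g h, A g -> A h -> psi (g + h) = psi g + psi h) /\
    (forall g, B g -> psi g = 0) in
  additive_mod V phi /\
  forall (W : lmodType rat) (psi : G -> W), additive_mod W psi ->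
    exists2 h : {linear V -> W}, forall g, A g -> h (phi g) = psi g &
      forall h' : {linear V -> W}, (forall g, A g -> h' (phi g) = psi g) ->
        h' =1 h.

Definition value_transcendental : Prop :=
  exists (V : vectType rat) (phi : G -> V),
    is_quotient_tensor_rat (value_group w) (value_group v) phi /\
    \dim {:V} = 1%N.

(* r, restricted to the valuation ring, is the residue map onto a residue
   field k of v. *)
Definition is_residue_map (F : fieldType) (u : valuation F G) (k : fieldType)
  (r : F -> k) : Prop :=
  let O := [set z | val_le (Some 0) (u z)] in
  [/\ r 1 = 1,
      forall y z, O y -> O z -> r (y + z) = r y + r z,
      forall y z, O y -> O z -> r (y * z) = r y * r z,
      forall z, O z -> (r z = 0 <-> u z <> Some 0) &
      forall c, exists2 z, O z & r z = c].

Definition residue_transcendental : Prop :=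
  exists (k l : fieldType) (rK : K -> k) (rL : L -> l) (e : {rmorphism k -> l}),
    [/\ is_residue_map v rK, is_residue_map w rL,
        forall z, val_le (Some 0) (v z) -> e (rK z) = rL (f z) &
        trdeg_eq1 e].

Definition valuation_transcendental : Prop :=
  value_transcendental \/ residue_transcendental.

End Transcendence.

Section PairsOfDefinition.
Variables (K Kbar : fieldType) (G : orderedAbType).
Variables (f : {rmorphism K -> Kbar}) (wbar : valuation (ratfun Kbar) G).

Let vbar : valuation Kbar G := val_restr (ratC Kbar) wbar.

(* The valuation wbar is vbar_(a, gamma): the polynomial with coefficients c
   in x - a is c \Po ('X - a%:P). *)
Definition pair_of_definition (a : Kbar) (gamma : G) : Prop :=
  value_group wbar gamma /\
  forall c : {poly Kbar},
    wbar (FracField.tofrac (c \Po ('X - a%:P))) =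
    \big[@val_min G/None]_(i < size c)
       val_add (vbar c`_i) (Some (gamma *+ i)).

Definition minimal_pair_of_definition (a : Kbar) (gamma : G) : Prop :=
  pair_of_definition a gamma /\
  forall b : Kbar, val_le (Some gamma) (vbar (a - b)) ->
    forall m n, has_degree f (adjoin f [set a]) m ->
      has_degree f (adjoin f [set b]) n -> (m <= n)%N.

End PairsOfDefinition.

Section Henselization.
Variables (k L : fieldType) (G : orderedAbType) (f : {rmorphism k -> L}).
Variable w : valuation L G.

(* To be used when L is an algebraic closure of the subfield F: the
   restriction of w to F has a unique extension to L. Any extension to L takes
   its values in the divisible hull of the value group of F, that is, up to
   equivalence, in the value group of w; so G can be fixed. *)
Definition henselian (F : {pred L}) : Prop :=
  forall w' : valuation L G, {in F, w' =1 w} -> w' =1 w.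

(* The smallest henselian subfield of (L, w) containing k. *)
Definition henselization : set L :=
  [set z | forall F : divringClosed L,
     (forall c, f c \in F) -> henselian F -> z \in F].

End Henselization.

(* The implicit constant field: the intersection of Kbar and K(x)^h in an
   algebraic closure Omega of Kbar(x) with valuation W. *)
Definition implicit_constant_field (K Kbar Omega : fieldType)
  (G : orderedAbType) (iota : {rmorphism K -> Kbar})
  (j : {rmorphism ratfun Kbar -> Omega}) (W : valuation Omega G) : set Kbar :=
  [set z | henselization (j \o ratfun_map iota)%FUN W (j (ratC Kbar z))].

(* Main.v *)
(* The henselization K^h lies in IC because, for a henselian field F between K(x)
   and Omega, the field F' of constants of F is henselian: the minimal
   polynomial over F of a constant has all its roots in Kbar, hence coefficients
   in F', and its roots all have the same value since they are conjugate over F.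

   Conversely, let z be in IC and let F0 be a henselian field between K and Kbar.
   An automorphism sigma of Kbar over F0 preserves the valuation of Kbar, and it
   fixes a since a is purely inseparable. Extended to Kbar(x) by sigma x = x, it
   then preserves the valuation given by the pair of definition (a, gamma), so it
   lifts to a valuation-preserving automorphism of Omega. The fixed field of all
   valuation-preserving automorphisms of Omega over K(x) is henselian, thus
   contains z, and sigma z = z. Therefore z is purely inseparable over F0. If z
   were not in F0, some power t of z would satisfy t^p \in F0 and t \notin F0. A
   subfield S of Omega that contains F0(x) and is maximal for t \notin S has
   Omega purely inseparable over it; so S is henselian, whence z, and with it t,
   is in S: a contradiction. *)
From HB Require Import structures.
Require Import Defs.
From mathcomp Require Import all_boot all_order all_algebra qfpoly.
From mathcomp Require Import ring.
From mathcomp Require Import boolp classical_sets.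

Set Implicit Arguments.
Unset Strict Implicit.
Unset Printing Implicit Defensive.

Import Order.TTheory GRing.Theory.

Local Open Scope ring_scope.

(** * Ordered abelian groups *)

Section OrderedAb.
Variable G : orderedAbType.
Implicit Types g h : G.

Lemma oag_leD g h g' h' : g <= h -> g' <= h' -> g + g' <= h + h'.
Proof.
move=> le1 le2; apply: le_trans (oag_leD2l g le2) _.
by rewrite ![_ + h']addrC; apply: oag_leD2l.
Qed.

Lemma oag_ltDr g h : 0 < g -> 0 <= h -> 0 < g + h.
Proof.
move=> g0 h0; apply: lt_le_trans g0 _.
by rewrite -{1}[g]addr0; apply: oag_leD2l.
Qed.

(** A total order excludes torsion: if g is nonzero, then g or its opposite is positive, and so are
    all positive multiples of it. *)
Lemma oag_mulrn_eq0 g n : g *+ n.+1 = 0 -> g = 0.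
Proof.
have pos (h : G) m : 0 <= h -> 0 <= h *+ m.
  by move=> h0; elim: m => // m IHm; rewrite mulrS -[0]addr0 oag_leD.
case/orP: (oag_total 0 g) => g0 gn; apply/eqP/negP => /negP gN0.
- have : 0 < g *+ n.+1 by rewrite mulrS oag_ltDr ?pos // lt_def gN0.
  by rewrite gn ltxx.
- have Ng0 : 0 < - g.
    rewrite lt_def oppr_eq0 gN0 -[0](addNr g) -{2}[- g]addr0.
    exact: oag_leD2l.
  have : 0 < (- g) *+ n.+1 by rewrite mulrS oag_ltDr ?pos ?ltW.
  by rewrite mulNrn gn oppr0 ltxx.
Qed.

Lemma oag_mulIn g h n : g *+ n.+1 = h *+ n.+1 -> g = h.
Proof.
move/eqP; rewrite -subr_eq0 -mulrnBl => /eqP/oag_mulrn_eq0/eqP.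
by rewrite subr_eq0 => /eqP.
Qed.

Lemma val_le_trans (x y z : option G) : val_le x y -> val_le y z -> val_le x z.
Proof. by case: x y z => [g|] [h|] [k|] //=; apply: le_trans. Qed.

End OrderedAb.

(** * Valuation rings and their maximal ideals *)

Section ValuationRing.
Variables (L : fieldType) (G : orderedAbType) (w : valuation L G).
Implicit Types x y z : L.

(** The valuation ring of [w] and, with [vpos], its maximal ideal. Most arguments below use only
    these two sets. *)
Definition vint x := val_le (Some 0) (w x).
Definition vpos x := vint x && (w x != Some 0).

Lemma val0 : w 0 = None.
Proof. by rewrite valuation_eq_oo. Qed.

Lemma val_neq0 x : x != 0 -> exists g, w x = Some g.
Proof.
move=> x0; case Ew: (w x) => [g|]; first by exists g.
by move: x0; rewrite (iffLR (valuation_eq_oo _ _) Ew) eqxx.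
Qed.

Lemma val_Some_neq0 x g : w x = Some g -> x != 0.
Proof. by move=> wx; apply/eqP => x0; rewrite x0 val0 in wx. Qed.

Lemma val1 : w 1 = Some 0.
Proof.
have [g wg] := val_neq0 (oner_neq0 L).
have := valuationM w 1 1; rewrite mulr1 wg /= => -[/eqP].
by rewrite -{1}[g]addr0 (inj_eq (addrI g)) => /eqP <-.
Qed.

(** Twice [w (-1)] is [w 1], that is 0, and the value group has no torsion. *)
Lemma valN x : w (- x) = w x.
Proof.
have [g wg] : exists g, w (-1) = Some g by apply/val_neq0; rewrite oppr_eq0 oner_neq0.
have := valuationM w (-1) (-1); rewrite mulrNN mulr1 val1 wg /= => -[/esym gg].
have g0 : g = 0 by apply: (@oag_mulrn_eq0 _ _ 1); rewrite mulr2n.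
by rewrite -mulN1r valuationM wg g0 /=; case: (w x) => //= h; rewrite add0r.
Qed.

Lemma valV x g : w x = Some g -> w x^-1 = Some (- g).
Proof.
move=> wx; have x0 := val_Some_neq0 wx.
have [h wh] : exists h, w x^-1 = Some h by apply: val_neq0; rewrite invr_eq0.
have := valuationM w x x^-1; rewrite divff // val1 wx wh /= => -[/esym/eqP].
by rewrite addrC addr_eq0 => /eqP->.
Qed.

Lemma valX x g n : w x = Some g -> w (x ^+ n) = Some (g *+ n).
Proof.
by move=> wx; elim: n => [|n IHn]; rewrite ?val1 // exprS valuationM wx IHn mulrS.
Qed.

Lemma vint0 : vint 0. Proof. by rewrite /vint val0. Qed.
Lemma vint1 : vint 1. Proof. by rewrite /vint val1 /=. Qed.
Lemma vintN x : vint (- x) = vint x. Proof. by rewrite /vint valN. Qed.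

Lemma vintM x y : vint x -> vint y -> vint (x * y).
Proof.
rewrite /vint valuationM; case: (w x) (w y) => [g|] [h|] //= g0 h0.
by rewrite -[0]addr0 oag_leD.
Qed.

Lemma vintD x y : vint x -> vint y -> vint (x + y).
Proof.
rewrite /vint => x0 y0; apply: val_le_trans (valuationD w x y).
by rewrite /val_min; case: ifP.
Qed.

Lemma vint_sum (I : Type) (r : seq I) (P : pred I) (F : I -> L) :
  (forall i, P i -> vint (F i)) -> vint (\sum_(i <- r | P i) F i).
Proof. by move=> intF; elim/big_ind: _; [apply: vint0 | apply: vintD |]. Qed.

Lemma vintX x n : vint x -> vint (x ^+ n).
Proof. by move=> xi; elim: n => [|n IHn]; rewrite ?vint1 // exprS vintM. Qed.

Lemma vposW x : vpos x -> vint x. Proof. by case/andP. Qed.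

Lemma vpos0 : vpos 0. Proof. by rewrite /vpos vint0 val0. Qed.

Lemma vposN x : vpos (- x) = vpos x.
Proof. by rewrite /vpos vintN valN. Qed.

Lemma vposE x g : w x = Some g -> vpos x = (0 < g).
Proof. by rewrite /vpos /vint => -> /=; rewrite lt_def andbC (inj_eq Some_inj). Qed.

Lemma vposMr x y : vpos x -> vint y -> vpos (x * y).
Proof.
have [->|x0] := eqVneq x 0; first by rewrite mul0r vpos0.
have [->|y0] := eqVneq y 0; first by rewrite mulr0 vpos0.
have [[g wx] [h wy]] := (val_neq0 x0, val_neq0 y0).
have wxy : w (x * y) = Some (g + h) by rewrite valuationM wx wy.
rewrite (vposE wx) (vposE wxy) /vint wy; exact: oag_ltDr.
Qed.

Lemma vposMl x y : vint x -> vpos y -> vpos (x * y).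
Proof. by move=> xi yp; rewrite mulrC vposMr. Qed.

Lemma vpos_unit x : vint x -> vpos x = (w x != Some 0).
Proof. by rewrite /vpos => ->. Qed.

Lemma vintV x : vint x -> ~~ vpos x -> vint x^-1.
Proof.
by move=> xi; rewrite vpos_unit // negbK /vint => /eqP /valV->; rewrite oppr0 /=.
Qed.

Lemma vintVn x : ~~ vint x -> vpos x^-1.
Proof.
rewrite /vint; case wx: (w x) => [g|] //= g0.
rewrite (vposE (valV wx)) lt_def oppr_eq0; case/orP: (oag_total 0 g) => [|g1].
  by rewrite (negPf g0).
rewrite (contraNneq _ g0) ?(oag_leD2l (-g) g1) => [|->//].
by have := oag_leD2l (-g) g1; rewrite addNr addr0.
Qed.

Lemma vposD x y : vpos x -> vpos y -> vpos (x + y).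
Proof.
have [->|x0] := eqVneq x 0; first by rewrite add0r.
have [->|y0] := eqVneq y 0; first by rewrite addr0.
move=> xp yp.
(* Factor out the summand of smaller value; the cofactor 1 + y / x or 1 + x / y is then integral. *)
have [xy|xy] := boolP (vint (y / x)).
  by rewrite -[x + y](mulfVK x0) mulrDl divff // mulrC vposMr // vintD ?vint1.
have := vintVn xy; rewrite invf_div => /vposW xy'.
by rewrite -[x + y](mulfVK y0) mulrDl divff // mulrC vposMr // vintD ?vint1.
Qed.

Lemma vpos_sum (I : Type) (r : seq I) (P : pred I) (F : I -> L) :
  (forall i, P i -> vpos (F i)) -> vpos (\sum_(i <- r | P i) F i).
Proof. by move=> intF; elim/big_ind: _; [apply: vpos0 | apply: vposD |]. Qed.

Lemma vpos_prodP (I : eqType) (r : seq I) (F : I -> L) :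
  (forall i, i \in r -> vint (F i)) -> vpos (\prod_(i <- r) F i) ->
  exists2 i, i \in r & vpos (F i).
Proof.
elim: r => [|i r IHr] intF; first by rewrite big_nil /vpos val1 eqxx andbF.
rewrite big_cons; have [Fi _|Fi] := boolP (vpos (F i)).
  by exists i; rewrite ?mem_head.
have iF : vint (F i) by rewrite intF ?mem_head.
move=> pFr; have [||j jr Fj] := IHr; last by exists j; rewrite ?inE ?jr ?orbT.
  by move=> j jr; rewrite intF ?inE ?jr ?orbT.
suff <- : (F i)^-1 * (F i * \prod_(j <- r) F j) = \prod_(j <- r) F j.
  by rewrite vposMl ?vintV.
by rewrite mulKf // (contraNneq _ Fi) // => ->; rewrite vpos0.
Qed.

Lemma vunit_vpos x e : w x = Some 0 -> vpos e -> w (x + e) = Some 0.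
Proof.
move=> wx ep; have xi : vint x by rewrite /vint wx /=.
apply/eqP; rewrite -[_ == _]negbK -vpos_unit ?vintD ?(vposW ep) //.
apply/negP=> xep; have : vpos (x + e - e) by rewrite vposD ?vposN.
by rewrite addrK vpos_unit // wx eqxx.
Qed.

Lemma vint_XsubC_prod (s : seq L) i : (forall x, x \in s -> vint x) ->
  vint (\prod_(x <- s) ('X - x%:P))`_i.
Proof.
elim: s i => [|x s IHs] i si.
  by rewrite big_nil coef1 /=; case: eqP; rewrite ?vint0 ?vint1.
have xi : vint x by rewrite si ?mem_head.
have {}IHs j : vint (\prod_(x <- s) ('X - x%:P))`_j.
  by apply: IHs => y ys; rewrite si ?inE ?ys ?orbT.
rewrite big_cons mulrBl coefB coefXM coefCM vintD ?vintN ?vintM //.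
by case: eqP; rewrite ?vint0.
Qed.

(** Valuation rings are integrally closed: if y is not integral, 1/y is in the maximal ideal, and
    dividing p(y) = 0 by the leading power of y puts 1 in the maximal ideal. *)
Lemma vint_monic_root (p : {poly L}) y :
  p \is monic -> (forall i, vint p`_i) -> root p y -> vint y.
Proof.
move=> mp ip /rootP py; apply: contraT => /[dup] yN /vintVn yp.
have y0 : y != 0 by apply: contraNneq yN => ->; apply: vint0.
have sp : (0 < size p)%N by rewrite size_poly_gt0 monic_neq0.
move: py; rewrite horner_coef -(prednK sp) big_ord_recr /= -lead_coefE.
rewrite (monicP mp) mul1r => /eqP; rewrite addrC addr_eq0 => /eqP Ey.
have : vpos 1; last by rewrite /vpos val1 eqxx andbF.
rewrite -(@mulfV _ (y ^+ (size p).-1)) ?expf_neq0 // {1}Ey mulNr vposN.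
rewrite mulr_suml vpos_sum // => -[i ltin] _ /=; rewrite -mulrA vposMl //.
rewrite -exprVn -(subnKC ltin) addSn exprS exprD.
rewrite [y^-1 * _]mulrC !mulrA -exprMn mulfV // expr1n mul1r.
by rewrite vposMl // vintX // vposW.
Qed.

End ValuationRing.

(** * Comparison of valuations on algebraic extensions *)

Section LastMinimum.
Variables (L : fieldType) (G : orderedAbType) (w : valuation L G).

Lemma vintV_vposN x : ~~ vpos w x -> vint w x^-1.
Proof.
move=> xN; have [xi|xi] := boolP (vint w x); first exact: vintV.
exact: vposW (vintVn xi).
Qed.

(** The index s is the last one at which F takes its least value. This serves for the terms of a
    vanishing sum p(t) and for the coefficients of p. *)
Lemma val_last_min (F : nat -> L) n : (exists2 i, (i < n)%N & F i != 0) ->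
  exists s, [/\ (s < n)%N, F s != 0, forall k, (k < n)%N -> vint w (F k / F s) &
    forall k, (s < k < n)%N -> vpos w (F k / F s)].
Proof.
elim: n => [|n IHn] [i ltin Fi] //.
case: (pselect (exists2 j, (j < n)%N & F j != 0)) => [/IHn|noj].
  case=> s [ltsn Fs Fint Fpos].
  have [Fnp|FnN] := boolP (vpos w (F n / F s)).
    exists s; split=> // [|k|k]; first exact: ltnW.
      by rewrite ltnS leq_eqVlt => /predU1P[->|/Fint//]; apply: vposW.
    rewrite ltnS [(k <= n)%N]leq_eqVlt => /andP[ltsk /predU1P[->//|ltkn]].
    by rewrite Fpos ?ltsk.
  have Fn : F n != 0 by apply: contraNneq FnN => ->; rewrite mul0r vpos0.
  have Fsn : vint w (F s / F n) by rewrite -invf_div; apply: vintV_vposN.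
  exists n; split=> // [k|k]; last by rewrite ltnS; case: ltngtP.
  rewrite ltnS leq_eqVlt => /predU1P[->|/Fint Fks]; first by rewrite divff ?vint1.
  by have := vintM Fks Fsn; rewrite mulrA mulfVK.
have F0 j : (j < n)%N -> F j = 0.
  by move=> ltjn; apply/eqP/negP => /negP Fj; apply: noj; exists j.
have Fn : F n != 0.
  by move: ltin Fi; rewrite ltnS leq_eqVlt => /predU1P[<-//|/F0->]; rewrite eqxx.
exists n; split=> // [k|k]; last by rewrite ltnS; case: ltngtP.
by rewrite ltnS leq_eqVlt => /predU1P[->|/F0->]; rewrite ?mul0r ?vint0 ?divff ?vint1.
Qed.

End LastMinimum.

Section Domination.
Variables (L : fieldType) (G : orderedAbType).
Implicit Types v : valuation L G.

(** A unit for v' is a unit for v, its inverse being integral too. For t algebraic over A, two terms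
    of p(t) have the same value under v', so their ratio is a unit for both valuations. Hence v t
    and v' t have the same multiple by the difference of the two degrees, and torsion-freeness makes
    them equal. *)
Lemma eq_val_vint (A : set L) v v' : (forall t, algebraic_over A t) ->
  (forall c, A c -> v c = v' c) -> (forall t, vint v' t -> vint v t) -> v =1 v'.
Proof.
move=> algA eqA dom t.
have unit x : v' x = Some 0 -> v x = Some 0.
  move=> x0; have xi : vint v' x by rewrite /vint x0 /=.
  have xVi : vint v' x^-1 by rewrite /vint (valV x0) oppr0 /=.
  apply/eqP; rewrite -[_ == _]negbK -vpos_unit ?dom //; apply/negP=> xp.
  have xN0 := val_Some_neq0 x0.
  have := vposMr xp (dom _ xVi); rewrite mulfV //.
  by rewrite vpos_unit ?vint1 ?val1 ?eqxx.
have [->|t0] := eqVneq t 0; first by rewrite !val0.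
have [p [p0 Ap /rootP pt]] := algA t.
pose F i := p`_i * t ^+ i.
have sp : (0 < size p)%N by rewrite size_poly_gt0.
have [|s [ltsp Fs Fint Fpos]] := @val_last_min _ _ v' F (size p).
  exists (size p).-1; first by rewrite prednK.
  by rewrite mulf_neq0 ?expf_neq0 // -lead_coefE lead_coef_eq0.
have [ps ts] : p`_s != 0 /\ t ^+ s != 0.
  by apply/andP; rewrite -negb_or -mulf_eq0.
(* If the least value were attained only at s, then p(t) = 0 divided by the term of index s would
   put 1 in the maximal ideal. *)
have [l [ltlp neqls Fl]] :
    exists l, [/\ (l < size p)%N, l != s & v' (F l / F s) = Some 0].
  apply: contrapT => nol.
  have: vpos v' 1; last by rewrite vpos_unit ?vint1 ?val1 ?eqxx.
  move: pt; rewrite horner_coef (bigD1 (Ordinal ltsp)) //= => /eqP.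
  rewrite addr_eq0 => /eqP Es.
  rewrite -[1](divff Fs) {1}/F Es mulNr vposN mulr_suml vpos_sum //.
  move=> [i ltip]; rewrite -val_eqE /= => nis; rewrite vpos_unit ?Fint //.
  by apply/eqP => Fi; apply: nol; exists i.
have Flv := unit _ Fl.
have Fl0 : F l != 0.
  by apply: contraNneq (val_Some_neq0 Fl) => ->; rewrite mul0r.
have [pl tl] : p`_l != 0 /\ t ^+ l != 0.
  by apply/andP; rewrite -negb_or -mulf_eq0.
have [[g vt] [g' vt']] := (val_neq0 v t0, val_neq0 v' t0).
have [[a va] [b vb]] := (val_neq0 v ps, val_neq0 v pl).
have [va' vb'] : v' p`_s = Some a /\ v' p`_l = Some b by rewrite -!eqA.
have vF (u : valuation L G) c d h i :
    u t = Some h -> u p`_s = Some c -> u p`_l = Some d ->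
    u (F l / F s) = Some i -> h *+ l + d = h *+ s + c + i.
  move=> ut us ul; have uFs : u (F s) = Some (c + h *+ s).
    by rewrite /F valuationM us (valX s ut).
  rewrite valuationM (valV uFs) {1}/F valuationM ul (valX l ut) /= => -[<-].
  by rewrite [h *+ s + c]addrC [_ - _]addrC addNKr addrC.
have := vF _ _ _ _ _ vt va vb Flv; have := vF _ _ _ _ _ vt' va' vb' Fl.
rewrite !addr0 vt vt' => E' E; congr Some.
have {E E'} E : g *+ l - g *+ s = g' *+ l - g' *+ s.
  have D (h : G) : h *+ l + b = h *+ s + a -> h *+ l - h *+ s = a - b.
    by move=> E1; apply/eqP; rewrite subr_eq -(inj_eq (addIr b)) E1 addrAC addrNK addrC.
  by rewrite (D _ E) (D _ E').
clear - neqls E; wlog ltls : l s neqls E / (l < s)%N.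
  move=> hwlog; move: (neqls); rewrite neq_ltn => /orP[ltls|ltsl].
    exact: hwlog neqls E ltls.
  apply: (hwlog s l) => //; first by rewrite eq_sym.
  by apply: oppr_inj; rewrite !opprB.
move: E => /(congr1 -%R); rewrite !opprB -!mulrnBr ?(ltnW ltls) //.
by rewrite -(prednK (_ : 0 < s - l)%N) ?subn_gt0 // => /oag_mulIn.
Qed.

(* The tail b of p(t) / (p_s t^s) and t b are integral for every extension of the
   valuation of the coefficients, whatever the sign of v t; so t = (t b) / b is a
   quotient of elements on which all the extensions are nonnegative. *)
Lemma horner_tail_vint v (p : {poly L}) t s
    (b := \sum_(s <= k < size p) p`_k / p`_s * t ^+ (k - s)) :
  (s < size p)%N -> p`_s != 0 -> (forall k, (k < size p)%N -> vint v (p`_k / p`_s)) ->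
  (forall k, (s < k < size p)%N -> vpos v (p`_k / p`_s)) -> root p t ->
  [/\ vint v b, vint v (t * b) & vint v t -> v b = Some 0].
Proof.
move=> ltsp ps pint ppos /rootP pt.
(* For integral t this shows that b is a unit: every further term lies in the maximal ideal. *)
have bE : b = 1 + \sum_(s.+1 <= k < size p) p`_k / p`_s * t ^+ (k - s).
  by rewrite /b big_ltn // divff // subnn mulr1.
have [ti|tN] := boolP (vint v t).
  have vb : v b = Some 0.
    rewrite bE vunit_vpos ?val1 // big_nat_cond.
    rewrite vpos_sum // => k /andP[/ppos pk _]; rewrite vposMr ?vintX //.
  by have bi : vint v b; [rewrite /vint vb /= | split=> //; apply: vintM].
have t0 : t != 0 by apply: contraNneq tN => ->; apply: vint0.
have ti := vposW (vintVn tN).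
suff tb : vint v (t * b).
  split=> //.
  by rewrite -[b](mulKf t0) vintM.
(* Since p(t) = 0, the tail is minus the head, which divided by p_s and the power s - 1 of t is a
   polynomial in 1/t with integral coefficients. *)
have -> : t * b = - \sum_(0 <= k < s) p`_k / p`_s * t^-1 ^+ (s.-1 - k).
  move: pt; rewrite horner_coef.
  rewrite -(big_mkord xpredT (fun i => p`_i * t ^+ i))
    (@big_cat_nat _ _ _ s 0%N (size p)) ?(ltnW ltsp) //=.
  move/eqP; rewrite addrC addr_eq0 => /eqP E.
  (* For s = 0 the tail is all of p(t) / p_0, so b = 0, and the sum on the right is empty. *)
  case: s @b ltsp ps pint ppos E bE => [|s] b ltsp ps pint ppos E bE.
    move: E; rewrite ![X in - X]big_geq // oppr0 => E.
    rewrite [X in _ = - X]big_geq // oppr0.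
    rewrite (_ : b = 0) ?mulr0 //; apply: (mulfI ps).
    rewrite mulr0 -[RHS]E /b mulr_sumr; apply: eq_bigr => k _.
    by rewrite subn0 mulrA [p`_0 * _]mulrC divfK.
  apply: (mulfI (expf_neq0 s t0)); apply: (mulfI ps).
  transitivity (\sum_(s.+1 <= i < size p) p`_i * t ^+ i).
    rewrite !mulr_sumr; apply: eq_big_nat => k /andP[lesk _].
    have -> : t ^+ k = t ^+ s * t * t ^+ (k - s.+1) by rewrite -exprSr -exprD subnKC.
    have [c ->] : exists c, p`_k = p`_s.+1 * c.
      by exists (p`_k / p`_s.+1); rewrite mulrC divfK.
    by rewrite [_ * c]mulrC mulfK //; ring.
  rewrite E !mulrN; congr (- _); rewrite !mulr_sumr.
  rewrite big_nat [RHS]big_nat; apply: eq_bigr => k /andP[_ ltks].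
  have -> : t ^+ s = t ^+ k * t ^+ (s - k) by rewrite -exprD subnKC.
  have [c ->] : exists c, p`_k = p`_s.+1 * c.
    by exists (p`_k / p`_s.+1); rewrite mulrC divfK.
  rewrite exprVn [p`_s.+1 * c]mulrC mulfK //.
  have tt : t ^+ (s - k) * (t ^+ (s - k))^-1 = 1 by rewrite mulfV ?expf_neq0.
  by rewrite -[LHS]mulr1 -tt /=; ring.
rewrite vintN big_nat_cond vint_sum // => k /andP[/andP[_ ltks] _].
by rewrite vintM ?vintX // pint // (ltn_trans ltks).
Qed.

End Domination.

(** * Finite families of valuations *)

Section FiniteFamily.
Variables (N : fieldType) (G : orderedAbType) (A : set N).
Variables (v : valuation N G) (I : finType) (v_ : I -> valuation N G).
Hypothesis algA : forall t, algebraic_over A t.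
Hypothesis eqA : forall i c, A c -> v_ i c = v c.

(* Prime avoidance, for the centers of the v_i in the intersection of their
   valuation rings. *)
Lemma vpos_avoidance :
  (forall i, exists u,
     [/\ vpos v u, forall j, vint (v_ j) u & ~~ vpos (v_ i) u]) ->
  exists u, [/\ vpos v u, forall j, vint (v_ j) u & forall j, ~~ vpos (v_ j) u].
Proof.
move=> avoid1.
suff avoid n (s : {set I}) : #|s| = n ->
    exists u, [/\ vpos v u, forall j, vint (v_ j) u &
      forall j, j \in s -> ~~ vpos (v_ j) u].
  have [u [vu iu pu]] := avoid _ [set: I] erefl.
  by exists u; split=> // j; rewrite pu ?inE.
elim: n s => [|n IHn] s sn.
  exists 0; split=> [|j|j]; rewrite ?vpos0 ?vint0 //.
  by rewrite (cards0_eq sn) inE.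
(* By induction, x_k avoids the centers of all members of s other than k. *)
have /choice[x xP] k : exists u, k \in s -> [/\ vpos v u, forall j, vint (v_ j) u &
    forall j, j \in s :\ k -> ~~ vpos (v_ j) u].
  have [ks|] := boolP (k \in s); last by exists 0.
  have [|u uP] := IHn (s :\ k); last by exists u.
  by move: sn; rewrite (cardsD1 k) ks => -[].
have [[k ks xk]|allpos] := pselect (exists2 k, k \in s & ~~ vpos (v_ k) (x k)).
  have [vx ix px] := xP k ks; exists (x k); split=> // j js.
  by have [->//|jk] := eqVneq j k; rewrite px // !inE jk.
have {}allpos k : k \in s -> vpos (v_ k) (x k).
  by move=> ks; apply/negPn/negP => xk; apply: allpos; exists k.
have [k ks] : exists k, k \in s by apply/set0Pn; rewrite -card_gt0 sn.
have [vx ix px] := xP k ks.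
(* A singleton is treated apart, by the hypothesis itself: the product over the other members would
   be the empty product 1, which is not positive for [v]. *)
case: n => [|n] in sn IHn *.
  have [u [vu iu pu]] := avoid1 k; exists u; split=> // j js.
  have /cards1P[l sl] : #|s| == 1 by rewrite sn.
  by move: ks js; rewrite sl !inE => /eqP<- /eqP->.
have xint l j : l \in s -> vint (v_ j) (x l) by move=> /xP[].
have prodE (j : I) : j \in s -> j != k -> exists2 c,
    \prod_(l in s :\ k) x l = x j * c & (forall i, vint (v_ i) c) /\ vint v c.
  move=> js jk; exists (\prod_(l in s :\ k :\ j) x l).
    by rewrite (big_setD1 j) // !inE jk.
  split=> [i|].
    elim/big_ind: _ => [||l]; [exact: vint1 | exact: vintM |].
    by rewrite !inE => /and3P[_ _ /xint].
  elim/big_ind: _ => [||l]; [exact: vint1 | exact: vintM |].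
  by rewrite !inE => /and3P[_ _ /xP[/vposW]].
have [l ls lk] : exists2 l, l \in s & l != k.
  have /set0Pn[l] : s :\ k != finset.set0.
    by rewrite -card_gt0; move: sn; rewrite (cardsD1 k) ks add1n => -[->].
  by rewrite !inE => /andP[lk ls]; exists l.
have Pk : v_ k (\prod_(l in s :\ k) x l) = Some 0.
  elim/big_ind: _ => [|y z yk zk|j]; first exact: val1.
    by rewrite valuationM yk zk /= addr0.
  rewrite !inE => /andP[jk js]; have [_ _ pj] := xP j js.
  by apply/eqP; rewrite -[_ == _]negbK -vpos_unit ?xint // pj // !inE eq_sym jk.
(* At k the product is a unit and x_k is positive; at any other j in s the product is positive,
   having x_j as a factor, and x_k is a unit. *)
exists (x k + \prod_(l in s :\ k) x l); split=> [|j|j js].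
- have [c -> [_ cv]] := prodE l ls lk; have [vl _ _] := xP l ls.
  by rewrite vposD ?vposMr.
- have [c -> [ci _]] := prodE l ls lk.
  by rewrite vintD ?vintM ?xint.
have [->|jk] := eqVneq j k.
  by rewrite /vpos addrC (vunit_vpos Pk) ?allpos // eqxx andbF.
have [c -> [ci _]] := prodE j js jk.
have : ~~ vpos (v_ j) (x k) by rewrite px // !inE jk.
apply: contra => xcp; rewrite -[x k](addrK (x j * c)) vposD // vposN vposMr //.
exact: allpos.
Qed.

(** By avoidance, the hypothesis yields an i such that every u positive for [v] and integral for the
    whole family is positive for v_i. If t is integral for v_i, the tail b of [horner_tail_vint] is
    a unit for v_i, hence not positive for [v]; so t = (t b) / b is integral for [v], and
    [eq_val_vint] applies. *)
Lemma exists_eq_val :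
  (forall u, vpos v u -> (forall i, vint (v_ i) u) -> exists i, vpos (v_ i) u) ->
  exists i, v_ i =1 v.
Proof.
move=> posP; apply: contrapT => noeq.
have [|u [vu iu pu]] := vpos_avoidance; last first.
  by have [i] := posP u vu iu; rewrite (negPf (pu i)).
move=> i; apply: contrapT => noavoid; apply: noeq; exists i => t; symmetry; move: t.
apply: (eq_val_vint algA) => [c Ac|t ti]; first by rewrite eqA.
have [p [p0 Ap pt]] := algA t.
have sp : (0 < size p)%N by rewrite size_poly_gt0.
have [|s [ltsp ps pint ppos]] := @val_last_min _ _ v (fun k => p`_k) (size p).
  by exists (size p).-1; rewrite ?prednK // -lead_coefE lead_coef_eq0.
pose b := \sum_(s <= k < size p) p`_k / p`_s * t ^+ (k - s).
have [vb vtb _] := horner_tail_vint ltsp ps pint ppos pt.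
have div_eq j k : v_ j (p`_k / p`_s) = v (p`_k / p`_s).
  have [g vs] := val_neq0 v ps.
  by rewrite !valuationM eqA // (valV vs) (valV (_ : v_ j _ = Some g)) // eqA.
have tail j := @horner_tail_vint _ _ (v_ j) p t s ltsp ps.
have {}tail j : [/\ vint (v_ j) b, vint (v_ j) (t * b) &
    vint (v_ j) t -> v_ j b = Some 0].
  apply: tail => // k => [/pint|/ppos]; by rewrite /vpos /vint div_eq.
have [_ _ /(_ ti) vib] := tail i.
have vb0 : ~~ vpos v b.
  apply/negP => vbp; apply: noavoid; exists b; split=> // [j|].
    by have [] := tail j.
  by rewrite /vpos vib eqxx andbF.
have b0 := val_Some_neq0 vib.
by rewrite -[t](mulfK b0) vintM // vintV.
Qed.

End FiniteFamily.

(** * Minimal polynomials and simple algebraic extensions *)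

Section MinimalPolynomial.
Variables (M L : fieldType) (f : {rmorphism M -> L}).

Lemma algebraic_minpoly y : algebraicOver f y ->
  exists m : {poly M}, [/\ monic_irreducible_poly m, root (map_poly f m) y &
    forall q, root (map_poly f q) y -> m %| q].
Proof.
move=> /integral_algebraic[p mp py].
pose P n := `[< exists2 m : {poly M}, m \is monic &
  (size m == n) && root (map_poly f m) y >].
have [|n /asboolP[m mm /andP[/eqP sm my]] minm] := @ex_minnP P.
  by exists (size p); apply/asboolP; exists p; rewrite ?eqxx.
have m0 := monic_neq0 mm.
have small q : q != 0 -> root (map_poly f q) y -> (n <= size q)%N.
  move=> q0 qy; apply: minm; apply/asboolP; exists ((lead_coef q)^-1 *: q).
    by rewrite monicE lead_coefZ mulVf ?lead_coef_eq0.
  rewrite size_scale ?invr_eq0 ?lead_coef_eq0 // eqxx linearZ /=.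
  by rewrite rootZ ?fmorph_eq0 ?invr_eq0 ?lead_coef_eq0.
have dvd q : root (map_poly f q) y -> m %| q.
  move=> qy; apply: contraT => r0; have := ltn_modp q m; rewrite m0 => ltr.
  suff : root (map_poly f (q %% m)) y.
    by move=> /(small _ r0); rewrite -sm leqNgt ltr.
  move: qy; rewrite {1}(divp_eq q m) rmorphD rmorphM /= /root hornerD hornerM.
  by rewrite (rootP my) mulr0 add0r.
exists m; split=> //; split=> //; split=> [|q sq qm].
  have: size (map_poly f m) != 1%N.
    apply: contraL my => /size_poly1P[c c0 ->]; by rewrite rootC.
  by rewrite size_map_poly; move: m0; rewrite -size_poly_eq0; case: (size m) => [|[]].
have /dvdpP[c mE] := qm.
have [c0 q0] : c != 0 /\ q != 0.
  by apply/andP; rewrite -negb_or -mulf_eq0 -mE.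
move: (my); rewrite mE rmorphM rootM => /orP[cy|qy]; last first.
  by rewrite /eqp -mE qm dvd.
have /dvdp_leq := dvd _ cy; rewrite mE size_mul // => /(_ c0).
have sc : (0 < size c)%N by rewrite size_poly_gt0.
have := sq; rewrite -size_poly_eq0 in q0.
by case: (size q) q0 => [|[|k]] // _ _; rewrite addnS /= addnS ltnNge leq_addr.
Qed.

End MinimalPolynomial.

Section RootField.
Variables (M : fieldType) (m : {poly M}) (mi : monic_irreducible_poly m).
Local Notation N := {poly %/ m with mi}.

Definition qf_const : M -> N := @qpolyC M m.

Fact qf_const_zmod : zmod_morphism qf_const.
Proof. by move=> a b; rewrite /qf_const qpolyCD qpolyCN. Qed.
Fact qf_const_monoid : monoid_morphism qf_const.
Proof. by split=> // a b; apply: qpolyCM. Qed.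
HB.instance Definition _ := GRing.isZmodMorphism.Build M N qf_const qf_const_zmod.
HB.instance Definition _ := GRing.isMonoidMorphism.Build M N qf_const qf_const_monoid.

Definition qf_root : N := in_qpoly m 'X.

Lemma qf_hornerE (x : N) : (map_poly qf_const (val x)).[qf_root] = x.
Proof.
rewrite /qf_root -[RHS](_ : in_qpoly m (val x \Po 'X) = x).
  by rewrite in_qpoly_comp_horner.
by apply: val_inj; rewrite /= comp_polyXr Pdiv.CommonRing.rmodp_small ?size_mk_monic.
Qed.

Lemma qf_rootP : root (map_poly qf_const m) qf_root.
Proof.
rewrite /qf_root; apply/rootP; rewrite -[LHS](in_qpoly_comp_horner m m 'X) comp_polyXr.
by apply: val_inj; rewrite /= mk_monicE // Pdiv.RingMonic.rmodpp ?mi.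
Qed.

Lemma qf_alg (x : N) : algebraicOver qf_const x.
Proof.
rewrite -[x]qf_hornerE; apply/integral_algebraic/integral_horner.
  by apply/integral_poly => i; rewrite coef_map; apply: integral_id.
by exists m; [apply: mi.2 | exact: qf_rootP].
Qed.

Section Eval.
Variables (L : fieldType) (f : {rmorphism M -> L}) (y : L).

Definition qf_eval (x : N) : L := (map_poly f (val x)).[y].

Hypothesis my : root (map_poly f m) y.

Lemma qf_eval_mod p :
  (map_poly f (Pdiv.Ring.rmodp p (mk_monic m))).[y] = (map_poly f p).[y].
Proof.
rewrite mk_monicE // [in RHS](Pdiv.RingMonic.rdivp_eq mi.2 p) rmorphD rmorphM /=.
by rewrite hornerD hornerM (rootP my) mulr0 add0r.
Qed.

Lemma qf_eval_rmorphism : exists tau : {rmorphism N -> L},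
  (forall c, tau (qf_const c) = f c) /\ tau qf_root = y.
Proof.
have zm : zmod_morphism qf_eval.
  by move=> u v; rewrite /qf_eval /= rmorphB hornerD hornerN.
have mm : monoid_morphism qf_eval.
  split=> [|u v]; first by rewrite /qf_eval (_ : val _ = 1) // rmorph1 hornerC.
  by rewrite /qf_eval /= qf_eval_mod rmorphM hornerM.
pose tau1 := GRing.isZmodMorphism.Build N L qf_eval zm.
pose tau2 := GRing.isMonoidMorphism.Build N L qf_eval mm.
exists (HB.pack_for {rmorphism N -> L} qf_eval tau1 tau2); split=> [c|] /=.
  by rewrite /qf_eval /= map_polyC hornerC.
by rewrite /qf_eval /= qf_eval_mod map_polyX hornerX.
Qed.

End Eval.

Lemma qf_rmorphism_eq (L : fieldType) (f : {rmorphism M -> L})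
    (tau tau' : {rmorphism N -> L}) :
  (forall c, tau (qf_const c) = f c) -> (forall c, tau' (qf_const c) = f c) ->
  tau qf_root = tau' qf_root -> tau =1 tau'.
Proof.
move=> tc tc' tX x; rewrite -[x]qf_hornerE -!horner_map tX -!map_poly_comp.
by congr (_.[_]); apply: eq_map_poly => c /=; rewrite tc tc'.
Qed.

End RootField.

(** * Subfields *)

Section Subfield.
Variables (L : fieldType) (F : divringClosed L).

(** Gives a subfield a type of its own, over which one can form polynomials, rational functions and
    morphisms. *)
Record subfield : predArgType :=
  Subfield { subfield_val : L; subfieldP : subfield_val \in F }.

HB.instance Definition _ := [isSub for subfield_val].
HB.instance Definition _ := [Choice of subfield by <:].
HB.instance Definition _ := [SubChoice_isSubComUnitRing of subfield by <:].
HB.instance Definition _ := [SubComUnitRing_isSubIntegralDomain of subfield by <:].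
HB.instance Definition _ := [SubIntegralDomain_isSubField of subfield by <:].

Definition subfield_incl : {rmorphism subfield -> L} := val.

End Subfield.

Lemma divringClosed_of_set (L : fieldType) (A : set L) :
  A 1 -> (forall x y, A x -> A y -> A (x - y)) ->
  (forall x y, A x -> A y -> A (x / y)) ->
  exists F : divringClosed L, forall z, (z \in F) = `[< A z >].
Proof.
move=> A1 AB AD.
have cA : divring_closed (fun z => `[< A z >]).
  split=> [|x y|x y]; rewrite !unfold_in; first exact/asboolP.
    by move=> /asboolP Ax /asboolP Ay; apply/asboolP/AB.
  by move=> /asboolP Ax /asboolP Ay; apply/asboolP/AD.
pose F1 := GRing.isDivringClosed.Build L (fun z => `[< A z >]) cA.
by exists (HB.pack_for (divringClosed L) (fun z => `[< A z >]) F1).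
Qed.

Lemma rmorphism_to_subfield (L k : fieldType) (f : {rmorphism k -> L})
    (F : divringClosed L) :
  (forall c, f c \in F) ->
  exists g : {rmorphism k -> subfield F}, forall c, subfield_incl F (g c) = f c.
Proof.
move=> fF; pose g c := Subfield (fF c).
have zm : zmod_morphism g by move=> x y; apply: val_inj; rewrite /= rmorphB.
have mm : monoid_morphism g.
  by split=> [|x y]; apply: val_inj; rewrite /= ?rmorph1 ?rmorphM.
pose g1 := GRing.isZmodMorphism.Build k (subfield F) g zm.
pose g2 := GRing.isMonoidMorphism.Build k (subfield F) g mm.
by exists (HB.pack_for {rmorphism k -> subfield F} g g1 g2).
Qed.

Lemma algebraicOver_sub (M M' L : fieldType) (f : {rmorphism M -> L})
    (f' : {rmorphism M' -> L}) y :
  (forall c, exists c', f' c' = f c) -> algebraicOver f y -> algebraicOver f' y.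
Proof.
move=> ff' [p p0 py]; apply/integral_algebraic.
apply: (@integral_root _ _ f' (map_poly f p)); rewrite ?map_poly_eq0 //.
apply/integral_poly => i; rewrite coef_map /=; have [c' <-] := ff' p`_i.
exact: integral_id.
Qed.

Lemma algebraic_subfield (L k : fieldType) (f : {rmorphism k -> L})
    (F : divringClosed L) :
  (forall c, f c \in F) -> (forall y, algebraicOver f y) ->
  forall y, algebraicOver (subfield_incl F) y.
Proof.
by move=> fF algf y; apply: algebraicOver_sub (algf y) => c; exists (Subfield (fF c)).
Qed.

(** * Extension of value-preserving morphisms *)

Section Zorn.
Local Open Scope classical_set_scope.

(** [Zorn_bigcup] also asks for the union of the empty chain, of which P need not hold. It is
    applied instead to the sets whose union with X0 satisfies P, so that the empty chain gives
    X0. *)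
Lemma Zorn_above (T : Type) (P : set (set T)) (X0 : set T) : P X0 ->
  (forall C : set (set T), C `<=` P -> total_on C subset -> C !=set0 ->
    P (\bigcup_(X in C) X)) ->
  exists A, [/\ P A, X0 `<=` A & forall B, P B -> A `<=` B -> B `<=` A].
Proof.
move=> P0 Pchain; pose Q (A : set T) := P (A `|` X0).
have [|A [QA maxA]] := @Zorn_bigcup T Q.
  move=> C CQ totC; rewrite /Q.
  have [[X CX]|C0] := pselect (C !=set0); last first.
    rewrite (_ : _ `|` _ = X0) //; apply/seteqP; split=> x; last by right.
    by case=> // -[X CX]; case: C0; exists X.
  rewrite (_ : _ `|` _ = \bigcup_(Y in [set Y `|` X0 | Y in C]) Y).
    apply: Pchain => [_ [Y CY <-]|_ _ [Y CY <-] [Z CZ <-]|].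
    - exact: CQ.
    - by have [YZ|ZY] := totC _ _ CY CZ; [left | right]; apply: setSU.
    - by exists (X `|` X0); exists X.
  apply/seteqP; split=> x.
    case=> [[Y CY Yx]|X0x]; first by exists (Y `|` X0); [exists Y | left].
    by exists (X `|` X0); [exists X | right].
  by case=> _ [Y CY <-] [Yx|X0x]; [left; exists Y | right].
have AX0 : X0 `<=` A.
  apply: contrapT => X0A; apply: (maxA (A `|` X0)); last first.
    by rewrite /Q -setUA setUid.
  by split=> [x Ax|/(_ _ (or_intror _)) X0A']; [left | apply: X0A => x /X0A'].
exists A; split=> // [|B PB AB].
  by move: QA; rewrite /Q (setUidl AX0).
apply: contrapT => BA; apply: (maxA B); first by split.
by rewrite /Q (setUidl (subset_trans AX0 AB)).
Qed.

End Zorn.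

Section Extension.
Variables (L1 L2 : fieldType) (G : orderedAbType).
Variables (w1 : valuation L1 G) (w2 : valuation L2 G).

Local Open Scope classical_set_scope.

(* Any such R is the graph of a partial morphism: w1 a = w2 b makes b vanish
   when a does. *)
Record val_graph (R : set (L1 * L2)) : Prop := ValGraph {
  val_graph1 : R (1, 1);
  val_graphB : forall a b c d, R (a, b) -> R (c, d) -> R (a - c, b - d);
  val_graphM : forall a b c d, R (a, b) -> R (c, d) -> R (a * c, b * d);
  val_graphE : forall a b, R (a, b) -> w1 a = w2 b
}.

Lemma val_graph_neq0 R a b : val_graph R -> R (a, b) -> (a == 0) = (b == 0).
Proof.
move=> gR Rab; have E := val_graphE gR Rab.
apply/eqP/eqP => [a0|b0].
  by apply/(valuation_eq_oo w2); rewrite -E a0 val0.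
by apply/(valuation_eq_oo w1); rewrite E b0 val0.
Qed.

Lemma val_graph_fun R a b b' : val_graph R -> R (a, b) -> R (a, b') -> b = b'.
Proof.
move=> gR Rb Rb'; apply/eqP; rewrite -subr_eq0.
by rewrite -(val_graph_neq0 gR (val_graphB gR Rb Rb')) subrr.
Qed.

Lemma val_graph_rmorphism (M : fieldType) (h : {rmorphism M -> L1}) R :
  val_graph R -> (forall x, exists b, R (h x, b)) ->
  exists tau : {rmorphism M -> L2}, forall x, R (h x, tau x).
Proof.
move=> gR /choice[t tP].
have zm : zmod_morphism t.
  move=> x y; apply: (val_graph_fun gR (tP _)).
  by rewrite rmorphB; apply: val_graphB.
have mm : monoid_morphism t.
  split=> [|x y]; apply: (val_graph_fun gR (tP _)).
    by rewrite rmorph1; apply: val_graph1.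
  by rewrite rmorphM; apply: val_graphM.
pose t1 := GRing.isZmodMorphism.Build M L2 t zm.
pose t2 := GRing.isMonoidMorphism.Build M L2 t mm.
by exists (HB.pack_for {rmorphism M -> L2} t t1 t2).
Qed.

(** Makes a maximal graph closed under quotients, so that its domain is a subfield. *)
Lemma val_graph_frac R : val_graph R ->
  val_graph [set p | exists a b c d,
    [/\ R (a, b), R (c, d), c != 0 & p = (a / c, b / d)]].
Proof.
move=> gR; have d0 c d : R (c, d) -> c != 0 -> d != 0.
  by move=> Rcd; rewrite (val_graph_neq0 gR Rcd).
have D a b c d : R (a, b) -> R (c, d) -> R (a + c, b + d).
  move=> Rab Rcd; rewrite -[c]opprK -[d]opprK; apply: val_graphB => //.
  have R0 : R (0, 0) by have := val_graphB gR Rcd Rcd; rewrite !subrr.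
  by have := val_graphB gR R0 Rcd; rewrite !sub0r.
split.
- have R1 := val_graph1 gR.
  by exists 1, 1, 1, 1; rewrite oner_neq0 !divr1.
- move=> ? ? ? ? [a [b [c [d [Rab Rcd c0 [-> ->]]]]]].
  case=> [a' [b' [c' [d' [Rab' Rcd' c0' [-> ->]]]]]].
  exists (a * c' - a' * c), (b * d' - b' * d), (c * c'), (d * d').
  split; rewrite ?mulf_neq0 //; [|exact: val_graphM|].
    by apply: val_graphB => //; apply: val_graphM.
  have [dn dn'] := (d0 _ _ Rcd c0, d0 _ _ Rcd' c0').
  by congr (_, _); rewrite -[in LHS]mulNr addf_div // mulNr.
- move=> ? ? ? ? [a [b [c [d [Rab Rcd c0 [-> ->]]]]]].
  case=> [a' [b' [c' [d' [Rab' Rcd' c0' [-> ->]]]]]].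
  exists (a * a'), (b * b'), (c * c'), (d * d').
  by rewrite mulf_neq0 // !mulf_div; split=> //; apply: val_graphM.
- move=> ? ? [a [b [c [d [Rab Rcd c0 [-> ->]]]]]].
  have [g wg] := val_neq0 w1 c0; have wg' : w2 d = Some g.
    by rewrite -(val_graphE gR Rcd).
  by rewrite !valuationM (valV wg) (valV wg') (val_graphE gR Rab).
Qed.

(** The extension to M[y] sends p(y) to p(z). Equality of all values makes it well defined and
    injective, since only 0 has value oo; no equation for z has to be mentioned. *)
Definition one_step_extension := forall (M : fieldType)
  (f : {rmorphism M -> L1}) (g : {rmorphism M -> L2}),
  (forall c, w1 (f c) = w2 (g c)) -> forall y, algebraicOver f y ->
  exists z, forall p, w1 (map_poly f p).[y] = w2 (map_poly g p).[z].

(** Take a maximal graph R above that of the pair (f, g). Its domain is a subfield F, and the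
    one-step extension of F at any y gives a graph containing R, hence equal to R; so y is in F. *)
Lemma val_extension (M : fieldType)
    (f : {rmorphism M -> L1}) (g : {rmorphism M -> L2}) : one_step_extension ->
  (forall c, w1 (f c) = w2 (g c)) -> (forall y, algebraicOver f y) ->
  exists tau : {rmorphism L1 -> L2},
    (forall c, tau (f c) = g c) /\ forall x, w2 (tau x) = w1 x.
Proof.
move=> step fg algf.
have [||R [gR R0 maxR]] := @Zorn_above _ val_graph [set (f c, g c) | c in setT].
- split=> [|_ _ _ _ [x _ [<- <-]] [y _ [<- <-]]
          |_ _ _ _ [x _ [<- <-]] [y _ [<- <-]]|_ _ [x _ [<- <-]]].
  + by exists 1; rewrite ?rmorph1.
  + by exists (x - y); rewrite ?rmorphB.
  + by exists (x * y); rewrite ?rmorphM.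
  + exact: fg.
- move=> C CP totC [X CX].
  have chain p q : (\bigcup_(X in C) X) p -> (\bigcup_(X in C) X) q ->
      exists2 Z, C Z & Z p /\ Z q.
    move=> [Y CY Yp] [Z CZ Zq].
    by have [YZ|ZY] := totC _ _ CY CZ; [exists Z | exists Y] => //; split; auto.
  split=> [|a b c d Uab Ucd|a b c d Uab Ucd|a b [Y CY Yab]].
  + by exists X; [|apply: val_graph1 (CP _ CX)].
  + have [Z CZ [Zab Zcd]] := chain _ _ Uab Ucd.
    by exists Z; last apply: val_graphB (CP _ CZ) _ _ _ _ Zab Zcd.
  + have [Z CZ [Zab Zcd]] := chain _ _ Uab Ucd.
    by exists Z; last apply: val_graphM (CP _ CZ) _ _ _ _ Zab Zcd.
  + exact: val_graphE (CP _ CY) _ _ Yab.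
have Rdiv a b c d : R (a, b) -> R (c, d) -> R (a / c, b / d).
  (* For c = 0 also d = 0 and both quotients are 0 by convention; otherwise the graph of quotients
     is no larger than R. *)
  move=> Rab Rcd; have [c0|c0] := eqVneq c 0.
    have := val_graph_neq0 gR Rcd; rewrite c0 eqxx => /esym/eqP->.
    rewrite !invr0 !mulr0.
    by have := val_graphB gR Rab Rab; rewrite !subrr.
  apply: (maxR _ (val_graph_frac gR)); last by exists a, b, c, d.
  move=> [x y] Rxy; exists x, y, 1, 1; rewrite oner_neq0 !divr1.
  by split=> //; apply: val_graph1.
have [||a c [b Rab] [d Rcd]|F FE] :=
  @divringClosed_of_set L1 (fun a => exists b, R (a, b)).
- by exists 1; apply: val_graph1.
- by move=> a c [b Rab] [d Rcd]; exists (b - d); apply: val_graphB.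
- by exists (b / d); apply: Rdiv.
have [|gF gFP] := @val_graph_rmorphism _ (subfield_incl F) R gR.
  by move=> [x xF] /=; apply/asboolP; rewrite -FE.
have R_F a b : R (a, b) -> exists2 x, subfield_incl F x = a & gF x = b.
  move=> Rab; have aF : a \in F by rewrite FE; apply/asboolP; exists b.
  by exists (Subfield aF) => //; exact: (val_graph_fun gR (gFP (Subfield aF)) Rab).
have total y : exists b, R (y, b).
  have algy : algebraicOver (subfield_incl F) y.
    apply: algebraicOver_sub (algf y) => c.
    have [|s sc _] := R_F (f c) (g c); last by exists s.
    by apply: R0; exists c.
  have [|z zP] := step _ _ gF _ y algy.
    by move=> c; apply: val_graphE gR _ _ (gFP c).
  pose R' := [set q | exists p : {poly subfield F},
    q = ((map_poly (subfield_incl F) p).[y], (map_poly gF p).[z])].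
  have gR' : val_graph R'.
    split=> [|a b c d [p [-> ->]] [q [-> ->]]
            |a b c d [p [-> ->]] [q [-> ->]]|a b [p [-> ->]]].
    - by exists 1; rewrite !rmorph1 !hornerC.
    - by exists (p - q); rewrite !rmorphB /= !hornerD !hornerN.
    - by exists (p * q); rewrite !rmorphM /= !hornerM.
    - exact: zP.
  exists z; apply: (maxR _ gR') => [[a b]|]; last first.
    by exists 'X; rewrite !map_polyX !hornerX.
  move=> /R_F[x <- <-]; exists x%:P.
  by rewrite !map_polyC !hornerC.
have [tau tauP] := @val_graph_rmorphism _ idfun R gR total.
exists tau; split=> [c|x]; last by rewrite (val_graphE gR (tauP x)).
by apply: val_graph_fun gR (tauP _) _; apply: R0; exists c.
Qed.

End Extension.

(** * Extension of field morphisms and conjugation *)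

Section TrivialValuation.
Variable L : fieldType.

Definition int_oag : orderedAbType.
Proof.
by refine (@OrderedAb int _ _) => [x y|z x y xy];
  [apply: le_total | rewrite Num.Theory.lerD2l].
Defined.

(* With trivial valuations, extension of valuation-preserving morphisms is
   extension of field morphisms. *)
Definition trivial_val_fun (z : L) : option int_oag :=
  if z == 0 then None else Some 0.

Fact trivial_val_eq_oo z : trivial_val_fun z = None <-> z = 0.
Proof. by rewrite /trivial_val_fun; case: eqP. Qed.

Fact trivial_valM y z :
  trivial_val_fun (y * z) = val_add (trivial_val_fun y) (trivial_val_fun z).
Proof.
rewrite /trivial_val_fun mulf_eq0.
by case: eqP; case: eqP => //=; rewrite addr0.
Qed.

Fact trivial_valD y z :
  val_le (val_min (trivial_val_fun y) (trivial_val_fun z)) (trivial_val_fun (y + z)).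
Proof.
rewrite /trivial_val_fun; case: (y =P 0) => [->|_].
  by rewrite add0r /val_min; case: (z == 0).
by case: (z =P 0) => [->|_]; case: eqP.
Qed.

Definition trivial_val : valuation L int_oag :=
  Valuation trivial_val_eq_oo trivial_valM trivial_valD.

End TrivialValuation.

Section Conjugates.

Lemma qf_horner_rmorphism (M L : fieldType) (m : {poly M})
    (mi : monic_irreducible_poly m) (f : {rmorphism M -> L})
    (tau : {rmorphism {poly %/ m with mi} -> L}) p :
  (forall c, tau (qf_const mi c) = f c) ->
  tau (map_poly (qf_const mi) p).[qf_root mi] = (map_poly f p).[tau (qf_root mi)].
Proof.
move=> tc; rewrite -horner_map -map_poly_comp; congr (_.[_]).
exact: eq_map_poly.
Qed.

(** Any root z of the image of the minimal polynomial of y will do: evaluations at y and at z both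
    embed M[X]/(m), so p(y) and p(z) vanish together. *)
Lemma trivial_one_step (L1 : fieldType) (L2 : closedFieldType) :
  one_step_extension (trivial_val L1) (trivial_val L2).
Proof.
move=> M f g fg y /algebraic_minpoly[m [mi my _]].
have /closed_rootP[z mz] : size (map_poly g m) != 1%N.
  by rewrite size_map_poly; case: (mi.1) => + _; case: size => [|[]].
exists z => p.
have [tau [tauc <-]] := qf_eval_rmorphism mi my.
have [tau' [tauc' <-]] := qf_eval_rmorphism mi mz.
rewrite -!(qf_horner_rmorphism (mi := mi)) //= /trivial_val_fun.
by rewrite !fmorph_eq0.
Qed.

(** The embeddings of M[X]/(m) given by y and by z are the pair to be extended, with trivial
    valuations. *)
Lemma conj_rmorphism (M L1 : fieldType) (L2 : closedFieldType)
    (f : {rmorphism M -> L1}) (g : {rmorphism M -> L2}) m y z :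
  (forall x, algebraicOver f x) -> monic_irreducible_poly m ->
  root (map_poly f m) y -> root (map_poly g m) z ->
  exists tau : {rmorphism L1 -> L2}, (forall c, tau (f c) = g c) /\ tau y = z.
Proof.
move=> algf mi my mz.
have [tau1 [tauc1 <-]] := qf_eval_rmorphism mi my.
have [tau2 [tauc2 <-]] := qf_eval_rmorphism mi mz.
have [||tau [tauE _]] := val_extension (f := tau1) (g := tau2) (@trivial_one_step _ _).
- by move=> c; rewrite /= /trivial_val_fun !fmorph_eq0.
- by move=> x; apply: algebraicOver_sub (algf x) => c; exists (qf_const mi c).
by exists tau; split=> [c|]; rewrite -?tauc1 tauE.
Qed.

End Conjugates.

(** * Value-preserving extension into an algebraically closed field *)

Section OneStep.
Variables (L1 : fieldType) (L2 : closedFieldType) (G : orderedAbType).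
Variables (w1 : valuation L1 G) (w2 : valuation L2 G).

Lemma vpos_root_coef0 (L : fieldType) (v : valuation L G) (p : {poly L}) u :
  (forall i, vint v p`_i) -> vpos v u -> root p u -> vpos v p`_0.
Proof.
move=> pint up /rootP; rewrite horner_coef.
case sp: (size p) => [|n]; first by rewrite nth_default ?sp ?vpos0.
rewrite big_ord_recl expr0 mulr1 => /eqP; rewrite addr_eq0 => /eqP->.
rewrite vposN vpos_sum // => i _; rewrite vposMl //= exprS vposMr //.
by rewrite vintX // vposW.
Qed.

(* The valuations of M(y) considered are w1 and its competitors w2 o tau_i, one
   for each root of the image of the minimal polynomial of y. An element u that is
   positive for w1 and integral for the competitors cannot be a unit for all of
   them, since the w2 (tau_i u) are the values of the conjugates of u, hence
   determine the value of the constant coefficient of its minimal polynomial. *)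
Lemma closed_one_step : one_step_extension w1 w2.
Proof.
move=> M f g fg y /algebraic_minpoly[m [mi my _]].
have [tau1 [tauc1 tauX1]] := qf_eval_rmorphism mi my.
have [s] := closed_field_poly_normal (map_poly g m).
rewrite lead_coef_map (monicP mi.2) rmorph1 scale1r => ms.
have mroot z : root (map_poly g m) z = (z \in s) by rewrite ms root_prod_XsubC.
have /choice[tau tauP] (i : 'I_(size s)) :
    exists tau : {rmorphism {poly %/ m with mi} -> L2},
      (forall c, tau (qf_const mi c) = g c) /\ tau (qf_root mi) = s`_i.
  by apply: qf_eval_rmorphism; rewrite mroot mem_nth.
pose N := {poly %/ m with mi}.
pose v : valuation N G := val_restr tau1 w1.
pose v_ i : valuation N G := val_restr (tau i) w2.
have vc c : v (qf_const mi c) = w2 (g c) by rewrite /= tauc1 fg.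
have vic i c : v_ i (qf_const mi c) = w2 (g c) by rewrite /= (tauP i).1.
have [|||i vi] := @exists_eq_val N G (range (qf_const mi)) v _ v_.
- move=> t; have [p p0 pt] := qf_alg t.
  exists (map_poly (qf_const mi) p); split; rewrite ?map_poly_eq0 //.
  by move=> k; rewrite coef_map; exists p`_k.
- by move=> i _ [c _ <-]; rewrite vc vic.
- move=> u uv uint; apply: contrapT => npos.
  have [x [xi xu _]] := algebraic_minpoly (qf_alg u).
  have [r] := closed_field_poly_normal (map_poly g x).
  rewrite lead_coef_map (monicP xi.2) rmorph1 scale1r => xr.
  have rP z : z \in r -> vint w2 z /\ ~~ vpos w2 z.
    rewrite -root_prod_XsubC -xr => xz.
    (* A morphism sending u to its conjugate z sends the root of m to some s_i, hence is tau_i; so z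
       is the image of u under tau_i. *)
    have [tau' [tauc' tauu]] := conj_rmorphism (@qf_alg _ _ mi) xi xu xz.
    have : tau' (qf_root mi) \in s.
      rewrite -mroot /root -(qf_horner_rmorphism _ tauc').
      by rewrite (rootP (qf_rootP mi)) rmorph0.
    move=> /(nthP 0)[i ltis si].
    have tauE := qf_rmorphism_eq tauc' (tauP (Ordinal ltis)).1.
    rewrite -tauu tauE ?(tauP _).2 //; split; first exact: (uint (Ordinal ltis)).
    by apply/negP => up; apply: npos; exists (Ordinal ltis).
  have xint k : vint w2 (g x`_k).
    by rewrite -coef_map xr; apply: vint_XsubC_prod => z /rP[].
  (* As u is a positive root of its minimal polynomial x, the constant coefficient is positive; yet
     it is a product of opposites of conjugates of u, all units. *)
  have : vpos w2 (g x`_0).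
    have := @vpos_root_coef0 N v (map_poly (qf_const mi) x) u.
    rewrite coef_map /vpos /vint vc; apply=> // i.
    by rewrite coef_map vc; apply: xint.
  rewrite -coef_map -horner_coef0 xr horner_prod => /vpos_prodP[z zr|z zr].
    by rewrite hornerXsubC sub0r vintN; have [] := rP z zr.
  by rewrite hornerXsubC sub0r vposN; apply/negP; have [] := rP z zr.
exists s`_i => p; rewrite -(tauP i).2 -tauX1.
rewrite -(qf_horner_rmorphism p tauc1) -(qf_horner_rmorphism p (tauP i).1).
by rewrite -[LHS]/(v _) -vi.
Qed.

End OneStep.

(** * Henselian subfields *)

Section Henselian.
Variables (L : fieldType) (G : orderedAbType) (w : valuation L G).

(** If y is integral for [w], so are all the roots, and so are the coefficients, for [w] and hence
    for w'. As valuation rings are integrally closed, y is integral for w', and [eq_val_vint]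
    concludes. *)
Lemma henselian_of_roots (F : divringClosed L) :
  (forall y, exists s : seq L, [/\ y \in s,
     \prod_(r <- s) ('X - r%:P) \is a polyOver F & forall r, r \in s -> w r = w y]) ->
  henselian w F.
Proof.
move=> rootsF w' eqw.
apply: (@eq_val_vint _ _ [set z | z \in F]) => [t|c /= cF|t ti]; last 1 first.
- have [s [ts sF sw]] := rootsF t.
  apply: (@vint_monic_root _ _ w' (\prod_(r <- s) ('X - r%:P))).
  + exact: monic_prod_XsubC.
  + move=> i; rewrite /vint eqw ?(polyOverP sF) //.
    by apply: vint_XsubC_prod => r rs; rewrite /vint sw.
  + by rewrite root_prod_XsubC.
- have [s [ts sF sw]] := rootsF t; exists (\prod_(r <- s) ('X - r%:P)).
  rewrite monic_neq0 ?monic_prod_XsubC ?root_prod_XsubC //; split=> // i.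
  exact: (polyOverP sF).
- exact: eqw.
Qed.

End Henselian.

Section HenselianClosed.
Variables (L : closedFieldType) (G : orderedAbType) (w : valuation L G).

(** F is the fixed field of the value-preserving endomorphisms over k. The list of roots needed for
    y is its orbit, which is finite because y is algebraic over k. *)
Lemma henselian_fixed (k : fieldType) (f : {rmorphism k -> L}) :
  (forall y, algebraicOver f y) ->
  exists F : divringClosed L, [/\ forall c, f c \in F, henselian w F &
    forall tau : {rmorphism L -> L}, (forall c, tau (f c) = f c) ->
      (forall x, w (tau x) = w x) -> forall y, y \in F -> tau y = y].
Proof.
move=> algf; pose D (tau : {rmorphism L -> L}) :=
  (forall c, tau (f c) = f c) /\ (forall x, w (tau x) = w x).
have [||x y xF yF|F FE] :=
  @divringClosed_of_set L (fun y => forall tau, D tau -> tau y = y).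
- by move=> tau _; rewrite rmorph1.
- by move=> x y xF yF tau Dtau; rewrite rmorphB xF ?yF.
- by move=> tau Dtau; rewrite fmorph_div xF ?yF.
exists F; split=> [c||tau tauf tauw y]; first by rewrite FE; apply/asboolP => tau [].
- apply: henselian_of_roots => y.
  have [p p0 py] := algf y.
  have [s0] := closed_field_poly_normal (map_poly f p).
  rewrite lead_coef_map => ps.
  have ps0 z : root (map_poly f p) z = (z \in s0).
    by rewrite ps rootZ ?fmorph_eq0 ?lead_coef_eq0 // root_prod_XsubC.
  pose s := [seq r <- undup s0 | `[< exists2 tau, D tau & tau y = r >]].
  have Ds tau r : D tau -> r \in s -> tau r \in s.
    move=> Dtau; rewrite !mem_filter !mem_undup => /andP[/asboolP[tau' Dtau' <-] _].
    apply/andP; split.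
      apply/asboolP; exists (tau \o tau')%FUN => //.
      split=> [c|x] /=; first by rewrite Dtau'.1 Dtau.1.
      by rewrite Dtau.2 Dtau'.2.
    rewrite -ps0 /root.
    have -> : map_poly f p = map_poly (tau \o tau') (map_poly f p).
      rewrite -map_poly_comp; apply: eq_map_poly => c /=.
      by rewrite Dtau'.1 Dtau.1.
    by rewrite horner_map (rootP py) rmorph0.
  exists s; split.
  + rewrite mem_filter mem_undup -ps0 py andbT; apply/asboolP.
    by exists (@idfun L).
  + apply/polyOverP => i; rewrite FE; apply/asboolP => tau Dtau.
    rewrite -coef_map rmorph_prod; congr (_`_i).
    under eq_bigr => r _ do rewrite rmorphB /= map_polyX map_polyC.
    rewrite -(big_map tau xpredT (fun r => 'X - r%:P)).
    (* An injective map of the finite orbit into itself permutes it, so the product is invariant. *)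
    have us : uniq s by rewrite filter_uniq ?undup_uniq.
    have ut : uniq (map tau s) by rewrite map_inj_uniq //; apply: fmorph_inj.
    have sts : {subset map tau s <= s} by move=> _ /mapP[r rs ->]; apply: Ds.
    have szs : (size s <= size (map tau s))%N by rewrite size_map.
    have [_ eqs] := uniq_min_size ut sts szs.
    rewrite (perm_big s) //; exact: uniq_perm.
  + by move=> r; rewrite mem_filter => /andP[/asboolP[tau [_ tauw] <-] _].
- by rewrite FE => /asboolP; apply.
Qed.

Section Fixed.
Variables (F : divringClosed L).
Hypothesis algF : forall y, algebraicOver (subfield_incl F) y.

(** All conjugates of z equal z, so its minimal polynomial is a power of X - z. Writing the exponent
    as q n', with q its characteristic part (1 in characteristic 0), turns it into the n'-th power
    of X^q - z^q. *)
Lemma insep_of_fixed z :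
  (forall tau : {rmorphism L -> L}, (forall c, c \in F -> tau c = c) -> tau z = z) ->
  exists2 q, [pchar L].-nat q & z ^+ q \in F.
Proof.
move=> fixz; have [m [mi mz _]] := algebraic_minpoly (algF z).
have [s] := closed_field_poly_normal (map_poly (subfield_incl F) m).
rewrite lead_coef_map (monicP mi.2) rmorph1 scale1r => ms.
have {fixz} sz r : r \in s -> r = z.
  rewrite -root_prod_XsubC -ms => mr.
  have [tau [tauF <-]] := conj_rmorphism algF mi mz mr.
  by apply: fixz => c cF; apply: (tauF (Subfield cF)).
have {sz} ms' : map_poly (subfield_incl F) m = ('X - z%:P) ^+ size s.
  rewrite ms.
  have -> : \prod_(r <- s) ('X - r%:P) = \prod_(r <- nseq (size s) z) ('X - r%:P).
    by congr (\prod_(r <- _) _); apply/all_pred1P/allP => r /sz->; rewrite /= eqxx.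
  by rewrite big_nseq iter_mulr_1.
have n0 : (0 < size s)%N.
  rewrite lt0n; apply: contraL mz => /eqP s0.
  by rewrite ms' s0 expr0 /root hornerC oner_eq0.
pose q := ((size s)`_[pchar L])%N; pose n' := ((size s)`_([pchar L]^'))%N.
have q0 : (0 < q)%N by rewrite part_gt0.
have n'0 : n'%:R != 0 :> L by rewrite natf_neq0_pchar part_pnat.
exists q; first exact: part_pnat.
(* This coefficient, the second one in powers of X^q, is - n' z^q, and n' is invertible. *)
have : (map_poly (subfield_incl F) m)`_(n'.-1 * q) \in F.
  by rewrite coef_map subfieldP.
have -> : map_poly (subfield_incl F) m =
    (\prod_(r <- nseq n' (z ^+ q)) ('X - r%:P)) \Po 'X^q.
  rewrite ms' -(partnC [pchar L] n0) -/q -/n' exprM.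
  rewrite big_nseq iter_mulr_1 rmorphXn /= comp_polyB comp_polyX comp_polyC.
  congr (_ ^+ _); apply/eqP; rewrite eq_sym subr_eq rmorphXn /=.
  by rewrite -exprDn_pchar ?subrK // (eq_pnat _ (pchar_poly _)) part_pnat.
rewrite coef_comp_poly_Xn // dvdn_mull // mulnK //.
have -> : n'.-1 = (size (nseq n' (z ^+ q))).-1 by rewrite size_nseq.
rewrite coefPn_prod_XsubC ?size_nseq; last by apply: contraNneq n'0 => ->.
rewrite big_nseq iter_addr_0 rpredN -mulr_natr => zqF.
by rewrite -[_ ^+ _](mulfK n'0) rpred_div ?rpred_nat.
Qed.

End Fixed.
End HenselianClosed.

(** * Subfields maximal for avoiding an element *)

Lemma maximal_subfield_avoiding (L : fieldType) (E : divringClosed L) z :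
  z \notin E -> exists S : divringClosed L, [/\ {subset E <= S}, z \notin S &
    forall T : divringClosed L, {subset S <= T} -> z \notin T -> {subset T <= S}].
Proof.
move=> zE; pose P (A : set L) := [/\ A 1, forall x y, A x -> A y -> A (x - y),
  forall x y, A x -> A y -> A (x / y) & ~ A z].
have PF (F : divringClosed L) : z \notin F -> P [set x | x \in F]%classic.
  move=> zF; split=> [|x y|x y|] /=;
    [exact: rpred1 | exact: rpredB | exact: rpred_div | exact/negP].
have [||A [[A1 AB AD Az] EA maxA]] := @Zorn_above L P [set x | x \in E]%classic.
- exact: PF.
- move=> C CP totC [X CX].
  have chain x y : (\bigcup_(X in C) X)%classic x -> (\bigcup_(X in C) X)%classic y ->
      exists2 Z, C Z & Z x /\ Z y.
    move=> [Y CY Yx] [Z CZ Zy].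
    by have [YZ|ZY] := totC _ _ CY CZ; [exists Z | exists Y] => //; split; auto.
  split=> [|x y Ux Uy|x y Ux Uy|[Y CY Yz]].
  + by exists X => //; have [] := CP _ CX.
  + have [Z CZ [Zx Zy]] := chain _ _ Ux Uy; exists Z => //.
    by have [_ ZB _ _] := CP _ CZ; apply: ZB.
  + have [Z CZ [Zx Zy]] := chain _ _ Ux Uy; exists Z => //.
    by have [_ _ ZD _] := CP _ CZ; apply: ZD.
  + by have [_ _ _] := CP _ CY; apply.
have [S SE] := divringClosed_of_set A1 AB AD.
exists S; split=> [x xE||T ST zT x xT]; rewrite ?SE; first exact/asboolP/EA.
  exact/asboolP.
apply/asboolP; apply: (maxA _ (PF _ zT)) => // y Ay /=.
by apply: ST; rewrite SE; apply/asboolP.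
Qed.

(* If no power y^(p^e) lay in S, choose t among them of least degree n over S.
   Then z is an S-polynomial of degree less than n in t, and its p-th power
   would give an algebraic relation of degree less than n for t^p. *)
Lemma maximal_avoiding_insep (L : fieldType) (S : divringClosed L) p z :
  p \in [pchar L] -> z ^+ p \in S -> z \notin S ->
  (forall T : divringClosed L, {subset S <= T} -> z \notin T -> {subset T <= S}) ->
  (forall y, algebraicOver (subfield_incl S) y) ->
  forall y, exists e, y ^+ (p ^ e) \in S.
Proof.
move=> pL zpS zS maxS algS y; pose f := subfield_incl S.
pose Q n := `[< exists e (q : {poly subfield S}),
  [/\ q != 0, size q = n & root (map_poly f q) (y ^+ (p ^ e))] >].
have [|n /asboolP[e [q [q0 sq qt]]] minn] := @ex_minnP Q.
  have [q q0 qy] := algS y; exists (size q); apply/asboolP.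
  by exists 0, q; rewrite expn0 expr1.
exists e; apply: contraT => tS; set t := y ^+ (p ^ e) in qt tS *.
have [m [mi mt mdvd]] := algebraic_minpoly (algS t).
have lemn : (size m <= n)%N by rewrite -sq dvdp_leq // mdvd.
have [tau [tauc tauX]] := qf_eval_rmorphism mi mt.
have [||a b|T TE] := @divringClosed_of_set L (range tau).
- by exists 1; rewrite ?rmorph1.
- by move=> _ _ [a _ <-] [b _ <-]; exists (a - b); rewrite ?rmorphB.
- by move=> [c _ <-] [d _ <-]; exists (c / d); rewrite ?fmorph_div.
have ST : {subset S <= T}.
  move=> c cS; rewrite TE; apply/asboolP.
  by exists (qf_const mi (Subfield cS)); rewrite ?tauc.
(* T is S(t), strictly larger than S, so maximality forces z into it. *)
have : z \in T.
  apply: contraT => zT; have := maxS T ST zT t; rewrite (negPf tS); apply.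
  by rewrite TE; apply/asboolP; exists (qf_root mi).
rewrite TE => /asboolP[u _ uz].
have pM : p \in [pchar (subfield S)] by rewrite -(fmorph_pchar f).
have R_size : (size (val u) < size m)%N.
  by apply: leq_trans (size_mk_monic u) _; rewrite mk_monicE.
have zE : z = (map_poly f (val u)).[t].
  rewrite -uz -{1}(qf_hornerE u) (qf_horner_rmorphism _ tauc) tauX //.
(* The p-th power of z = u(t): Frobenius applied to the coefficients of u gives a polynomial with
   value z^p at t^p. *)
pose R' := map_poly (pFrobenius_aut pM) (val u) - (Subfield zpS)%:P.
have R't : root (map_poly f R') (y ^+ (p ^ e.+1)).
  have -> : map_poly f R' =
      map_poly f (map_poly (pFrobenius_aut pM) (val u)) - (z ^+ p)%:P.
    by rewrite rmorphB; congr (_ - _); apply: (map_polyC f).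
  rewrite /root hornerD hornerN hornerC.
  rewrite expnSr exprM -/t -(pFrobenius_autE pL t) -(pFrobenius_autE pL z).
  rewrite zE -horner_map -!map_poly_comp /= subr_eq0; apply/eqP; congr (_.[_]).
  by apply: eq_map_poly => c; rewrite /= !pFrobenius_autE; apply: (rmorphXn f).
have R'0 : R' = 0.
  apply: contraTeq R_size => R'0; rewrite -leqNgt.
  have : (n <= size R')%N.
    by apply: minn; apply/asboolP; exists e.+1, R'.
  move=> /(leq_trans lemn)/leq_trans; apply.
  rewrite (leq_trans (size_polyD _ _)) // geq_max size_map_poly leqnn size_polyN.
  rewrite (leq_trans (size_polyC_leq1 _)) // size_poly_gt0.
  apply: contraNneq zS => u0; rewrite zE u0 rmorph0 horner0.
  exact: rpred0.
(* As Frobenius is injective, R' = 0 makes u constant, which would put z in S. *)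
have uC : val u = ((val u)`_0)%:P.
  apply/polyP => [[|i]]; rewrite coefC //=.
  have := congr1 (fun r : {poly _} => r`_i.+1) R'0.
  rewrite coefB coefC subr0 coef0 coef_map /= => /eqP.
  by rewrite fmorph_eq0 => /eqP.
by move: zS; rewrite zE uC map_polyC hornerC subfieldP.
Qed.

(** The values of y under [w] and w' agree after multiplication by n, and the value group has no
    torsion. *)
Lemma henselian_of_insep (L : fieldType) (G : orderedAbType)
    (w : valuation L G) (S : divringClosed L) :
  (forall y, exists2 n, (0 < n)%N & y ^+ n \in S) -> henselian w S.
Proof.
move=> insep w' eqw y; have [->|y0] := eqVneq y 0; first by rewrite !val0.
have [[|n] // _ yn] := insep y; have := eqw _ yn.
have [[g wy] [h wy']] := (val_neq0 w y0, val_neq0 w' y0).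
by rewrite (valX _ wy) (valX _ wy') wy wy' => -[/oag_mulIn->].
Qed.

(** * Morphisms of rational function fields *)

Section RatfunMap.

Lemma ratfunP (K : fieldType) (r : ratfun K) :
  exists n d, d != 0 /\ r = FracField.tofrac n / FracField.tofrac d.
Proof.
exists (frac (generic_quotient.repr r)).1, (frac (generic_quotient.repr r)).2.
have d0 : (frac (generic_quotient.repr r)).2 != 0 by apply: denom_ratioP.
by split=> //; rewrite -ratfun_reprE mulfK ?tofrac_eq0.
Qed.

Lemma ratfun_map_ratC (K L : fieldType) (f : {rmorphism K -> L}) c :
  ratfun_map f (ratC K c) = ratC L (f c).
Proof. by rewrite /ratC /= ratfun_map_tofrac map_polyC. Qed.

Lemma ratfun_map_div (K L : fieldType) (f : {rmorphism K -> L}) n d :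
  ratfun_map f (FracField.tofrac n / FracField.tofrac d) =
  FracField.tofrac (map_poly f n) / FracField.tofrac (map_poly f d).
Proof. by rewrite -!ratfun_map_tofrac -fmorph_div. Qed.

Lemma ratfun_map_comp (K L M : fieldType) (f : {rmorphism K -> L})
    (g : {rmorphism L -> M}) (h : {rmorphism K -> M}) :
  (forall c, g (f c) = h c) ->
  forall r, ratfun_map g (ratfun_map f r) = ratfun_map h r.
Proof.
move=> gf r; have [n [d [_ ->]]] := ratfunP r.
have gfE p : map_poly g (map_poly f p) = map_poly h p.
  by rewrite -map_poly_comp; apply: eq_map_poly => c /=.
by rewrite !ratfun_map_div !gfE.
Qed.

(** A constant of L(x) lying in K(x) is a constant of K(x): in z d = n, compare the coefficients at
    the degree of d. *)
Lemma ratC_ratfun_map (K L : fieldType) (f : {rmorphism K -> L}) z r :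
  ratC L z = ratfun_map f r -> exists c, f c = z.
Proof.
have [n [d [d0 ->]]] := ratfunP r; rewrite ratfun_map_div => E.
have fd0 : map_poly f d != 0 by rewrite map_poly_eq0.
have {}E : z%:P * map_poly f d = map_poly f n.
  apply/eqP; rewrite -tofrac_eq tofracM; apply/eqP.
  by rewrite -[LHS]/(ratC L z * _) E mulfVK ?tofrac_eq0.
exists (n`_(size d).-1 / lead_coef d); rewrite fmorph_div -coef_map -E coefCM.
by rewrite coef_map mulfK // fmorph_eq0 lead_coef_eq0.
Qed.

End RatfunMap.

(** The q-th power map is additive, hence injective, and sigma a and a have the same q-th power. *)
Lemma insep_rmorphism (K L : fieldType) (iota : {rmorphism K -> L}) (a : L)
    (sigma : {rmorphism L -> L}) :
  purely_inseparable_elt iota a -> (forall c, sigma (iota c) = iota c) -> sigma a = a.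
Proof.
move=> [q qK [c aq]] sc; have qL : [pchar L].-nat q.
  by rewrite (eq_pnat _ (fmorph_pchar iota)).
have : sigma a ^+ q = a ^+ q by rewrite -rmorphXn aq.
rewrite -{1}[sigma a](subrK a) exprDn_pchar // -{2}[a ^+ q]add0r => /addIr/eqP.
by rewrite expf_eq0 subr_eq0 => /andP[_ /eqP].
Qed.

Lemma pair_of_definition_invariant (L : fieldType) (G : orderedAbType)
    (wbar : valuation (ratfun L) G) (a : L) (gamma : G) (sigma : {rmorphism L -> L}) :
  pair_of_definition wbar a gamma -> sigma a = a ->
  (forall c, wbar (ratC L (sigma c)) = wbar (ratC L c)) ->
  forall r, wbar (ratfun_map sigma r) = wbar r.
Proof.
move=> [_ defw] sa sw r.
have poly p : wbar (FracField.tofrac (map_poly sigma p)) = wbar (FracField.tofrac p).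
  (* The coefficients of c are those of p in powers of x - a. As sigma fixes a, it acts on these
     coefficients alone, and their values do not change. *)
  pose c := p \Po ('X + a%:P).
  have -> : p = c \Po ('X - a%:P).
    by rewrite /c -comp_polyA comp_polyD comp_polyX comp_polyC subrK comp_polyXr.
  rewrite map_comp_poly rmorphB /= map_polyX map_polyC /= sa !defw size_map_poly.
  by apply: eq_bigr => i _; rewrite coef_map /= sw.
have [n [d [d0 ->]]] := ratfunP r; rewrite ratfun_map_div !valuationM !poly.
have [g wd] : exists g, wbar (FracField.tofrac d) = Some g.
  by apply: val_neq0; rewrite tofrac_eq0.
by rewrite (valV wd) (valV (_ : _ = Some g)) // poly.
Qed.

Lemma map_prod_XsubC (K L : fieldType) (f : {rmorphism K -> L}) s :
  map_poly f (\prod_(z <- s) ('X - z%:P)) = \prod_(z <- map f s) ('X - z%:P).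
Proof.
rewrite big_map rmorph_prod; apply: eq_bigr => z _.
by rewrite rmorphB /= map_polyX map_polyC.
Qed.

Lemma closed_root_map (K : closedFieldType) (L : fieldType)
    (f : {rmorphism K -> L}) p r :
  p != 0 -> root (map_poly f p) r -> exists z, f z = r.
Proof.
move=> p0; have [s ->] := closed_field_poly_normal p.
rewrite map_polyZ rootZ ?fmorph_eq0 ?lead_coef_eq0 // map_prod_XsubC.
by rewrite root_prod_XsubC => /mapP[z _ ->]; exists z.
Qed.

(** * The implicit constant field *)

Section ImplicitConstantField.
Variables (G : orderedAbType) (K : fieldType).
Variables (Kbar : closedFieldType) (iota : {rmorphism K -> Kbar}).
Hypothesis Kbar_alg : forall z, algebraicOver iota z.
Variables (Omega : closedFieldType) (j : {rmorphism ratfun Kbar -> Omega}).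
Hypothesis Omega_alg : forall z, algebraicOver j z.
Variables (omegabar : valuation (ratfun Kbar) G) (W : valuation Omega G).
Hypothesis W_ext : val_extends j W omegabar.

Local Notation vbar := (val_restr (ratC Kbar) omegabar).
Local Notation jC := (j \o ratC Kbar)%FUN.
Local Notation jK := (j \o ratfun_map iota)%FUN.

Lemma jK_ratC c : jK (ratC K c) = jC (iota c).
Proof. by rewrite -[LHS]/(j (ratfun_map iota (ratC K c))) ratfun_map_ratC. Qed.

Lemma Omega_algebraic_jK y : algebraicOver jK y.
Proof.
have intC c : integralOver jK (jC c).
  have [p p0 pc] := Kbar_alg c.
  apply: (@integral_root _ _ _ (map_poly (jC \o iota)%FUN p)).
  - by rewrite map_poly_eq0.
  - by rewrite map_poly_comp /root horner_map (rootP pc) rmorph0.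
  - apply/integral_poly => i; rewrite coef_map.
    by rewrite -[X in integralOver _ X]/(jC (iota p`_i)) -jK_ratC; apply: integral_id.
have intX : integralOver jK (j (FracField.tofrac 'X)).
  suff -> : j (FracField.tofrac 'X) = jK (FracField.tofrac 'X) by apply: integral_id.
  by rewrite /= ratfun_map_tofrac map_polyX.
have intP p : integralOver jK (j (FracField.tofrac p)).
  suff -> : j (FracField.tofrac p) = (map_poly jC p).[j (FracField.tofrac 'X)].
    apply: integral_horner => //; apply/integral_poly => i.
    by rewrite coef_map; apply: intC.
  rewrite map_poly_comp horner_map; congr (j _).
  rewrite map_poly_comp horner_map /= -[in LHS](comp_polyXr p) /comp_poly.
  by [].
have intR r : integralOver jK (j r).
  by have [n [d [_ ->]]] := ratfunP r; rewrite fmorph_div; apply: integral_div.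
have [p p0 py] := Omega_alg y; apply/integral_algebraic.
apply: (@integral_root _ _ _ (map_poly j p)); rewrite ?map_poly_eq0 //.
by apply/integral_poly => i; rewrite coef_map; apply: intR.
Qed.

Lemma henselian_constants (F : divringClosed Omega) :
  (forall r, jK r \in F) -> henselian W F ->
  exists F' : divringClosed Kbar,
    (forall c, (c \in F') = (jC c \in F)) /\ henselian vbar F'.
Proof.
move=> KF henF.
have [||x y xF yF|F' F'E] := @divringClosed_of_set Kbar (fun c => jC c \in F).
- by rewrite rmorph1 rpred1.
- by move=> x y xF yF; rewrite rmorphB rpredB.
- by rewrite fmorph_div rpred_div.
exists F'; split=> [c|]; first by rewrite F'E asboolb.
apply: henselian_of_roots => y.
have algF := algebraic_subfield KF Omega_algebraic_jK.
have [m [mi my _]] := algebraic_minpoly (algF (jC y)).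
have [s] := closed_field_poly_normal (map_poly (subfield_incl F) m).
rewrite lead_coef_map (monicP mi.2) rmorph1 scale1r => ms.
have ms_root z : root (map_poly (subfield_incl F) m) z = (z \in s).
  by rewrite ms root_prod_XsubC.
have sP r : exists z, r \in s -> jC z = r /\ W r = W (jC y).
  have [rs|] := boolP (r \in s); last by exists 0.
  move: rs; rewrite -ms_root => mr.
  have [tau [tauF tauy]] := conj_rmorphism algF mi my mr.
  have tauK c : tau (jC (iota c)) = jC (iota c).
    by rewrite -jK_ratC; apply: (tauF (Subfield (KF (ratC K c)))).
  (* The valuation W composed with tau agrees with W on F, so the henselian property identifies
     them: conjugates over F have equal values. *)
  have Wtau : val_restr tau W =1 W.
    by apply: henF => x xF /=; congr (W _); apply: (tauF (Subfield xF)).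
  (* The conjugate r of y is a root of a polynomial over K, all of whose roots lie in Kbar. *)
  have [p p0 py] := Kbar_alg y.
  have : root (map_poly jC (map_poly iota p)) (tau (jC y)).
    have -> : map_poly jC (map_poly iota p) =
        map_poly tau (map_poly jC (map_poly iota p)).
      rewrite -!map_poly_comp; apply: eq_map_poly => c; exact/esym/tauK.
    by rewrite /root !horner_map (rootP py) !rmorph0.
  rewrite tauy => /closed_root_map[|z jz]; first by rewrite map_poly_eq0.
  by exists z => _; split=> //; rewrite -tauy; apply: Wtau.
have /choice[t tP] := sP.
exists (map t s); split.
- have ys : jC y \in s by rewrite -ms_root.
  apply/mapP; exists (jC y) => //; apply: (fmorph_inj jC).
  by have [] := tP _ ys.
- apply/polyOverP => i; rewrite F'E asboolb.
  have -> : jC (\prod_(r <- map t s) ('X - r%:P))`_i =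
      (map_poly (subfield_incl F) m)`_i.
    rewrite ms -coef_map map_prod_XsubC -map_comp.
    by rewrite (_ : map _ s = s) //; apply: map_id_in => r /tP[].
  by rewrite coef_map subfieldP.
- move=> _ /mapP[r rs ->]; have [jt Wr] := tP r rs.
  rewrite -[LHS]/(omegabar (ratC Kbar (t r))) -[RHS]/(omegabar (ratC Kbar y)) -!W_ext.
  by rewrite -[LHS]/(W (jC (t r))) jt Wr.
Qed.

Lemma henselization_sub_implicit_constant z :
  henselization iota vbar z -> implicit_constant_field iota j W z.
Proof.
move=> zh F KF henF; have [F' [F'E henF']] := henselian_constants KF henF.
rewrite -[j _]/(jC z) -F'E; apply: zh => // c.
by rewrite F'E -jK_ratC KF.
Qed.

Section Invariance.
Variable F0 : divringClosed Kbar.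
Hypothesis KF0 : forall c, iota c \in F0.
Hypothesis henF0 : henselian vbar F0.

Lemma implicit_constant_pth_root p z : p \in [pchar Kbar] ->
  implicit_constant_field iota j W z -> z ^+ p \in F0 -> z \in F0.
Proof.
move=> pK zIC zpF0; apply: contraT => zF0.
pose jF0 : {rmorphism ratfun (subfield F0) -> Omega} :=
  (j \o ratfun_map (subfield_incl F0))%FUN.
have [||_ _ [r _ <-] [s _ <-]|E EE] := @divringClosed_of_set Omega (range jF0).
- by exists 1; rewrite ?rmorph1.
- by move=> _ _ [r _ <-] [s _ <-]; exists (r - s); rewrite ?rmorphB.
- by exists (r / s); rewrite ?fmorph_div.
have F0E c : c \in F0 -> jC c \in E.
  move=> cF0; rewrite EE; apply/asboolP; exists (ratC _ (Subfield cF0)) => //.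
  rewrite -[LHS]/(j (ratfun_map (subfield_incl F0) (ratC _ (Subfield cF0)))).
  by rewrite ratfun_map_ratC.
have KE r : jK r \in E.
  have [kappa kappaE] := rmorphism_to_subfield KF0.
  rewrite EE; apply/asboolP; exists (ratfun_map kappa r) => //.
  by congr (j _); apply: ratfun_map_comp.
(* E is F0(x), whose only constants are the elements of F0. *)
have zE : jC z \notin E.
  rewrite EE; apply/asboolP => -[r _ /(fmorph_inj j)/esym/ratC_ratfun_map[c cz]].
  by move: zF0; rewrite -cz subfieldP.
have [S [ES zS maxS]] := maximal_subfield_avoiding zE.
have KS r : jK r \in S by apply: ES.
have pO : p \in [pchar Omega] by rewrite (fmorph_pchar jC).
have p0 : (0 < p)%N by rewrite prime_gt0 // (pcharf_prime pO).
have zpS : jC z ^+ p \in S by rewrite -rmorphXn ES ?F0E.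
have algS := algebraic_subfield KS Omega_algebraic_jK.
have := zIC S KS; rewrite -[j _]/(jC z) (negPf zS); apply.
apply: henselian_of_insep => y.
have [e ye] := maximal_avoiding_insep pO zpS zS maxS algS y.
by exists (p ^ e)%N; rewrite ?expn_gt0 ?p0.
Qed.

(** One prime p is removed from q at a time: the power q/p of z is again an implicit constant, and
    its p-th power lies in F0. *)
Lemma implicit_constant_insep q z : [pchar Kbar].-nat q ->
  implicit_constant_field iota j W z -> z ^+ q \in F0 -> z \in F0.
Proof.
have [n] := ubnP q; elim: n q z => // n IHn q z; rewrite ltnS => leqn qK zIC.
have [->|q1] := eqVneq q 1%N; first by rewrite expr1.
have q0 : (0 < q)%N by case/andP: qK.
have q_gt1 : (1 < q)%N by rewrite ltn_neqAle eq_sym q1.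
have p_pr : prime (pdiv q) by rewrite pdiv_prime.
have pK : pdiv q \in [pchar Kbar] by apply: pnatPpi qK _; rewrite pi_pdiv.
rewrite -(divnK (pdiv_dvd q)) exprM => zF0.
apply: (IHn (q %/ pdiv q)%N) => //.
- by rewrite (leq_trans _ leqn) // ltn_Pdiv ?prime_gt1.
- by apply: pnat_dvd qK; rewrite dvdn_div ?pdiv_dvd.
apply: implicit_constant_pth_root pK _ zF0 => F KF henF.
by rewrite -[j _]/(jC _) rmorphXn rpredX //; apply: zIC.
Qed.

Lemma implicit_constant_fixed a gamma z (sigma : {rmorphism Kbar -> Kbar}) :
  pair_of_definition omegabar a gamma -> purely_inseparable_elt iota a ->
  implicit_constant_field iota j W z ->
  (forall c, c \in F0 -> sigma c = c) -> sigma z = z.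
Proof.
move=> defa a_insep zIC sF0.
have sK c : sigma (iota c) = iota c by apply: sF0.
have svbar : val_restr sigma vbar =1 vbar.
  by apply: henF0 => c cF0 /=; rewrite sF0.
have sW := pair_of_definition_invariant defa (insep_rmorphism a_insep sK) svbar.
(* The action of sigma on Kbar(x) preserves values, hence lifts to a value-preserving tau on Omega,
   which fixes K(x). *)
have [||tau [tauj tauW]] := val_extension (f := j) (g := (j \o ratfun_map sigma)%FUN)
  (@closed_one_step _ _ _ W W).
- by move=> r /=; rewrite !W_ext sW.
- exact: Omega_alg.
have tauK r : tau (jK r) = jK r.
  by rewrite /= tauj /=; congr (j _); apply: ratfun_map_comp.
have [F [KF henF fixF]] := henselian_fixed W Omega_algebraic_jK.
have := fixF tau tauK tauW _ (zIC F KF henF).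
rewrite tauj /= => /(fmorph_inj j).
rewrite -[LHS]/(ratfun_map sigma (ratC Kbar z)) ratfun_map_ratC.
exact: (fmorph_inj (ratC Kbar)).
Qed.

End Invariance.

End ImplicitConstantField.

Theorem proposition7p1
  (G : orderedAbType) (K : fieldType)
  (Kbar : closedFieldType) (iota : {rmorphism K -> Kbar})
  (Kbar_alg : forall z, algebraicOver iota z)
  (Omega : closedFieldType) (j : {rmorphism ratfun Kbar -> Omega})
  (Omega_alg : forall z, algebraicOver j z)
  (nu : valuation K G)
  (omega : valuation (ratfun K) G)
  (omega_ext : val_extends (ratC K) omega nu)
  (omega_vt : valuation_transcendental (ratC K) nu omega)
  (omegabar : valuation (ratfun Kbar) G)
  (omegabar_ext : val_extends (ratfun_map iota) omegabar omega)
  (W : valuation Omega G)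
  (W_ext : val_extends j W omegabar)
  (a : Kbar)
  (a_min : exists gamma : G, minimal_pair_of_definition iota omegabar a gamma)
  (a_insep : purely_inseparable_elt iota a) :
  implicit_constant_field iota j W
  = henselization iota (val_restr (ratC Kbar) omegabar).
Proof.
apply/seteqP; split=> z; last exact: henselization_sub_implicit_constant.
(* The henselization of K is the intersection of the henselian F0 above K, so z is to be placed in
   each of them. *)
move=> zIC F0 KF0 henF0; have [gamma [defa _]] := a_min.
have algF0 := algebraic_subfield KF0 Kbar_alg.
have [|q qK zqF0] := insep_of_fixed algF0 (z := z).
  by move=> sigma; apply: implicit_constant_fixed KF0 henF0 _ _ _ _ defa a_insep zIC.
by apply: implicit_constant_insep qK zIC zqF0.
Qed.
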